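(* There are exactly $29$ diffeomorphism classes of $5$-dimensional real Bott manifolds of the form $M(A)=S^1\times_{\mathbb{Z}_2}M(B)$ with $M(B)$ a $4$-dimensional real Bott manifold, i.e. of $5$-dimensional real Bott manifolds admitting the maximal $S^1$-action.
   Context: A Bott matrix of size $n$ is an $n\times n$ upper triangular matrix $A=(a_{ij})$ with $a_{ii}=1$ for all $i$ and $a_{ij}\in\{0,1\}$ for $i<j$. Let $S^1\subset\mathbb{C}$ be the unit circle and $T^n=(S^1)^n$. A Bott matrix $A$ defines a free action of $(\mathbb{Z}_2)^n=\langle g_1,\dots,g_n\rangle$ on $T^n$ by $$g_i(z_1,\dots,z_n)=(z_1,\dots,z_{i-1},-z_i,\tilde z_{i+1},\dots,\tilde z_n),$$ where for $j>i$, $\tilde z_j=\bar z_j$ if $a_{ij}=1$ and $\tilde z_j=z_j$ if $a_{ij}=0$. The quotient smooth manifold $M(A)=T^n/(\mathbb{Z}_2)^n$ is called an ($n$-dimensional) real Bott manifold. $M(A)$ is said to admit the maximal $T^k$-action, where $k$ is the number of columns of $A$ whose only nonzero entry is the diagonal entry (equivalently, $k$ is the rank of the maximal central free abelian subgroup of $\pi_1(M(A))$; it is a diffeomorphism invariant). For $k=1$ this means $A=\begin{pmatrix}1& c\\ 0&B\end{pmatrix}$ with $B$ a Bott matrix of size $n-1$ and each of the columns $2,\dots,n$ of $A$ having at least two nonzero entries; one then writes $M(A)=S^1\times_{\mathbb{Z}_2}M(B)$. *)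

(* Defs.v *)
From HB Require Import structures.
From mathcomp Require Import all_boot all_order all_algebra.
From mathcomp Require Import complex.
From mathcomp Require Import all_classical all_reals all_analysis.

Set Implicit Arguments.
Unset Strict Implicit.
Unset Printing Implicit Defensive.

Import Order.TTheory GRing.Theory Num.Theory.
Import numFieldNormedType.Exports.

Local Open Scope classical_set_scope.
Local Open Scope ring_scope.
Local Open Scope quotient_scope.

Section BottMatrices.

(* The entries 0 and 1 are encoded as [false] and [true]. *)
Definition bott_mx n (A : 'M[bool]_n) : bool :=
  [forall i : 'I_n, A i i] &&
  [forall i : 'I_n, [forall j : 'I_n, (j < i)%N ==> ~~ A i j]].

Definition diag_columns n (A : 'M[bool]_n) : {set 'I_n} :=
  [set j : 'I_n | [forall i : 'I_n, A i j == (i == j)]]%SET.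

Definition maximal_torus_rank n (A : 'M[bool]_n) : nat := #|diag_columns A|.

Definition bott_mx_of_rank n (k : nat) : {set 'M[bool]_n} :=
  [set A : 'M[bool]_n | bott_mx A && (maximal_torus_rank A == k)]%SET.

(* Rank one is the block form defining S^1 x_{Z_2} M(B). *)
Lemma bott_mx_of_rank1P n (A : 'M[bool]_(1 + n)) :
  reflect (exists (c : 'rV[bool]_n) (B : 'M[bool]_n),
            [/\ A = block_mx (const_mx true) c (const_mx false) B, bott_mx B &
                forall j : 'I_n, (1 < #|[set i | A i (rshift 1 j)]%SET|)%N])
          (A \in bott_mx_of_rank (1 + n) 1).
Proof.
have diagB (D : 'M[bool]_(1 + n)) : bott_mx D -> lshift n ord0 \in diag_columns D.
  case/andP=> /forallP Ddiag /forallP Dupp; rewrite inE; apply/forallP => i.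
  case: (eqVneq i (lshift n ord0)) => [->|i0]; first by rewrite Ddiag.
  have /forallP/(_ (lshift n ord0))/implyP/= Di := Dupp i.
  by rewrite eqbF_neg Di // lt0n; apply: contra i0 => /eqP i0; apply/eqP/val_inj.
rewrite inE; apply: (iffP andP) => [[Abott /cards1P[j0 Aj0]]|].
- have := diagB _ Abott; rewrite Aj0 => /set1P j0E.
  have /andP[/forallP Adiag /forallP Aupp] := Abott.
  exists (ursubmx A), (drsubmx A); split.
  + rewrite -[LHS]submxK; congr block_mx; apply/matrixP => i j; rewrite !mxE.
      by rewrite !ord1 Adiag.
    have /forallP/(_ (lshift n j))/implyP/= Aij := Aupp (rshift 1 i).
    by rewrite (negbTE (Aij _)) // ord1.
  + apply/andP; split; apply/forallP => i; first by rewrite !mxE Adiag.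
    apply/forallP => j; apply/implyP => ji; rewrite !mxE.
    by have /forallP/(_ (rshift 1 j))/implyP := Aupp (rshift 1 i); apply.
  + move=> j; rewrite ltnNge; apply/negP => le1.
    have jA : rshift 1 j \in [set i | A i (rshift 1 j)]%SET by rewrite inE Adiag.
    suff : rshift 1 j \in diag_columns A.
      by rewrite Aj0 -j0E => /set1P /(congr1 val).
    rewrite inE; apply/forallP => i; case: (eqVneq i (rshift 1 j)) => [->|ij].
      by rewrite Adiag.
    rewrite eqbF_neg; apply: contraNN ij => Aij.
    by apply/eqP; apply: (card_le1_eqP le1) => //; rewrite inE.
- move=> [c [B [AE /andP[/forallP Bdiag /forallP Bupp] Acol]]].
  have Abott : bott_mx A.
    apply/andP; split; apply/forallP => i; rewrite AE.
      by case: (split_ordP i) => k ->; rewrite ?block_mxEul ?block_mxEdr ?mxE.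
    apply/forallP => j; apply/implyP.
    case: (split_ordP i) => k ->; case: (split_ordP j) => l ->.
    + by rewrite !ord1 ltnn.
    + by rewrite ord1.
    + by rewrite block_mxEdl mxE.
    + rewrite block_mxEdr ltn_add2l => lk.
      by have /forallP/(_ l)/implyP := Bupp k; apply.
  split=> //; apply/cards1P; exists (lshift n ord0).
  apply/setP => j; rewrite finset.in_set1; case: (split_ordP j) => k ->.
    by rewrite ord1 eqxx diagB.
  rewrite eq_rlshift; apply/negP; rewrite inE => /forallP Ak.
  have := Acol k; suff -> : [set i | A i (rshift 1 k)]%SET = [set rshift 1 k]%SET.
    by rewrite cards1.
  by apply/setP => i; rewrite !inE (eqP (Ak i)).
Qed.

End BottMatrices.

Section SmoothMaps.
Variable R : realType.

Fixpoint Ck_on n m (k : nat) (U : set 'rV[R]_n) (f : 'rV[R]_n -> 'rV[R]_m) :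
    Prop :=
  if k is k'.+1 then
    (forall x, U x -> differentiable f x) /\
    (forall v : 'rV[R]_n, Ck_on k' U (fun x => 'D_v f x))
  else forall x, U x -> {for x, continuous f}.

(* Meant for an open [U]: only then is it insensitive to [f] outside [U]. *)
Definition smooth_on n m (U : set 'rV[R]_n) (f : 'rV[R]_n -> 'rV[R]_m) : Prop :=
  forall k, Ck_on k U f.

Record chart (n : nat) (M : Type) := Chart {
  chart_dom : set M;
  chart_map :> M -> 'rV[R]_n
}.

(* The charts of the smooth structure that makes [p : R^n -> M] a local
   diffeomorphism: inverses of the injective restrictions of [p] to open sets.
   It is an atlas of [M] when [p] is the projection of R^n onto its quotient by
   a free, properly discontinuous group of diffeomorphisms. *)
Definition quotient_atlas n (M : Type) (p : 'rV[R]_n -> M) : set (chart n M) :=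
  [set c | exists V : set 'rV[R]_n,
    [/\ open V, set_inj V p, chart_dom c = p @` V & {in V, cancel p c}]].

Definition smooth_map m n (M N : Type) (atM : set (chart m M))
    (atN : set (chart n N)) (f : M -> N) : Prop :=
  forall x : M, exists (c : chart m M) (d : chart n N),
    [/\ atM c, atN d, chart_dom c x, f @` chart_dom c `<=` chart_dom d &
        exists2 g : 'rV[R]_m -> 'rV[R]_n,
          smooth_on (c @` chart_dom c) g &
          forall y, chart_dom c y -> g (c y) = d (f y)].

Definition diffeomorphism m n (M N : Type) (atM : set (chart m M))
    (atN : set (chart n N)) (f : M -> N) : Prop :=
  smooth_map atM atN f /\
  exists g : N -> M, [/\ cancel f g, cancel g f & smooth_map atN atM g].

End SmoothMaps.

Section RealBottManifolds.
Variable R : realType.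

Definition torus_pred n : pred 'rV[R[i]]_n :=
  fun z => [forall j, `|z ord0 j| == 1].

Definition torus n := {z : 'rV[R[i]]_n | torus_pred z}.
HB.instance Definition _ n := Choice.on (torus n).

Lemma torus_exp_subproof n (x : 'rV[R]_n) :
  torus_pred (\row_j (cos (x ord0 j) +i* sin (x ord0 j))%C).
Proof.
by apply/forallP => j; rewrite mxE normc_def /= cos2Dsin2 sqrtr1.
Qed.

Definition torus_exp n (x : 'rV[R]_n) : torus n := Sub _ (torus_exp_subproof x).

Definition bott_gen_row n (A : 'M[bool]_n) (i : 'I_n) (z : 'rV[R[i]]_n) :
    'rV[R[i]]_n :=
  \row_j (if j == i then - z ord0 j
          else if (i < j)%N && A i j then (z ord0 j)^* else z ord0 j).

Lemma bott_gen_subproof n (A : 'M[bool]_n) i (z : torus n) :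
  torus_pred (bott_gen_row A i (val z)).
Proof.
apply/forallP => j; have /forallP/(_ j) zj := valP z; rewrite mxE.
by case: ifP => _; [rewrite normrN | case: ifP => _; rewrite ?norm_conjC].
Qed.

Definition bott_gen n (A : 'M[bool]_n) (i : 'I_n) (z : torus n) : torus n :=
  Sub _ (bott_gen_subproof A i z).

Lemma bott_genK n (A : 'M[bool]_n) i : involutive (bott_gen A i).
Proof.
move=> z; apply/val_inj/rowP => j; rewrite mxE /= mxE.
by case: ifP => ->; [rewrite opprK | case: ifP => ->; rewrite ?conjCK].
Qed.

(* As the generators are involutions, words in them give the whole group. *)
Definition bott_orbit_rel n (A : 'M[bool]_n) : rel (torus n) :=
  fun z w => `[< exists s : seq 'I_n, w = foldr (bott_gen A) z s >].

Lemma bott_orbit_rel_equiv n (A : 'M[bool]_n) :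
  equiv_class_of (bott_orbit_rel A).
Proof.
have sym z w : bott_orbit_rel A z w -> bott_orbit_rel A w z.
  move=> /asboolP[s ->]; apply/asboolP; exists (rev s).
  elim: s => [//|i s IHs]; rewrite rev_cons /= foldr_rcons bott_genK.
  exact: IHs.
split.
- by move=> z; apply/asboolP; exists [::].
- by move=> z w; apply/idP/idP; exact: sym.
- move=> w z t /asboolP[s ->] /asboolP[s' ->]; apply/asboolP.
  by exists (s' ++ s); rewrite foldr_cat.
Qed.

Canonical bott_orbit_equiv n (A : 'M[bool]_n) :=
  EquivRelPack (bott_orbit_rel_equiv A).

Definition real_bott n (A : 'M[bool]_n) := {eq_quot (bott_orbit_equiv A)}.

Definition real_bott_proj n (A : 'M[bool]_n) (x : 'rV[R]_n) : real_bott A :=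
  \pi_(real_bott A) (torus_exp x).
Arguments real_bott_proj {n} A x.

Definition real_bott_atlas n (A : 'M[bool]_n) : set (chart R n (real_bott A)) :=
  quotient_atlas (real_bott_proj A).
Arguments real_bott_atlas {n} A.

Definition real_bott_diffeo n (A B : 'M[bool]_n) : Prop :=
  exists f : real_bott A -> real_bott B,
    diffeomorphism (real_bott_atlas A) (real_bott_atlas B) f.

End RealBottManifolds.

(* Main.v *)
Require Import Defs.
From mathcomp Require Import all_boot all_order all_algebra.
From mathcomp Require Import fingroup perm complex zify ring lra.
From mathcomp Require Import all_classical all_reals all_analysis.

(** A diffeomorphism M(A) -> M(B) lifts to the universal coverings R^n, and the
    lift intertwines the two deck groups through an isomorphism.  The deck group
    of M(A) is Z^n with a product twisted by A.  Its squaring map induces a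
    quadratic map S : (Z/2)^n -> (2Z/4Z)^n, which an isomorphism preserves up to
    linear bijections on both sides.  So the numbers

      sum_v #{u | S u = S v}^2   and   #{(u, v) | S u + S v = S (u + v)}

    are diffeomorphism invariants.  Conversely, three elementary moves on Bott
    matrices are realised by affine diffeomorphisms: a permutation of the
    coordinates, a quarter translation of a circle, and a shear along two
    circles reflected by the same generators.  The 315 Bott matrices of size 5
    and rank one fall into 29 orbits under these moves, and the two invariants
    separate the orbits. *)

Set Implicit Arguments.
Unset Strict Implicit.
Unset Printing Implicit Defensive.

Import Order.TTheory GRing.Theory Num.Theory.
Import numFieldNormedType.Exports.

(** * The deck group of a real Bott manifold *)

Section BottGroup.
Local Open Scope ring_scope.
Variable n : nat.
Implicit Types (A : 'M[bool]_n) (u v w : 'rV[bool]_n) (a b m : 'rV[int]_n).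

(** The sum is taken in [bool] seen as the field F_2. Its value is the exponent of the sign that an
    element of parity [v] puts on the [j]-th coordinate. *)
Definition twist A v (j : 'I_n) : bool :=
  \sum_(i < n | (i < j)%N && A i j) v 0 i.

Definition par m : 'rV[bool]_n := map_mx (fun z : int => odd `|z|%N) m.

(* Z^n with the composition law of the maps
   [x |-> (+- x_j + m_j pi)_j] of R^n that lift the group action on the torus;
   the sign of the [j]-th entry depends only on the parities of [m_i], [i < j]. *)
Definition bott_mul A a b : 'rV[int]_n :=
  \row_j (a 0 j + (-1) ^+ twist A (par a) j * b 0 j).

Lemma twistD A u v j : twist A (u + v) j = twist A u j + twist A v j.
Proof.
by rewrite -big_split; apply: eq_bigr => i _; rewrite mxE.
Qed.

Lemma twist0 A j : twist A 0 j = false.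
Proof. by rewrite /twist big1 // => i _; rewrite mxE. Qed.

Lemma odd_absD (x y : int) : odd `|(x + y)%R|%N = odd `|x|%N (+) odd `|y|%N.
Proof. lia. Qed.

Lemma parD a b : par (a + b) = par a + par b.
Proof. by apply/rowP => j; rewrite !mxE odd_absD. Qed.

Lemma parN a : par (- a) = par a.
Proof. by apply/rowP => j; rewrite !mxE abszN. Qed.

Lemma par0 : par 0 = 0.
Proof. by apply/rowP => j; rewrite !mxE. Qed.

Lemma addvv u : u + u = 0.
Proof. by apply/rowP => j; rewrite !mxE; exact: addbb. Qed.

Lemma par_eq0P m : reflect (exists c, m = c *+ 2) (par m == 0).
Proof.
apply: (iffP eqP) => [m0|[c ->]]; last by rewrite mulr2n parD addvv.
exists (\row_j (m 0%R j %/ 2)%Z); rewrite [RHS]mulr2n; apply/rowP => j.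
have mj : odd `|m 0%R j|%N = false.
  by have := congr1 (fun u : 'rV_n => u 0 j) m0; rewrite !mxE.
by rewrite !mxE; lia.
Qed.

Lemma par_mul A a b : par (bott_mul A a b) = par a + par b.
Proof.
by apply/rowP => j; rewrite !mxE odd_absD abszM abszX /= exp1n mul1n.
Qed.

Lemma mul_even A a b : par a = 0 -> bott_mul A a b = a + b.
Proof. by move=> a0; apply/rowP => j; rewrite !mxE a0 twist0 mul1r. Qed.

Lemma mulb0 A a : bott_mul A a 0 = a.
Proof. by apply/rowP => j; rewrite !mxE mulr0 addr0. Qed.

(** The sign at position [i] depends only on entries before [i], so a multiple of one basis vector
    is squared by doubling. Even vectors are thereby sums of squares. *)
Lemma mul_delta A (c : int) i :
  bott_mul A (c *: delta_mx 0 i) (c *: delta_mx 0 i) =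
  (c *: delta_mx 0 i) *+ 2.
Proof.
apply/rowP => j; rewrite mulr2n !mxE; case: (eqVneq j i) => [->|_]; last first.
  by rewrite andbF !mulr0 addr0.
rewrite /twist big1 ?mul1r // => k /andP[ki _].
by rewrite !mxE (_ : k == i = false) ?andbF ?mulr0 ?val_eqE -?val_eqE ?ltn_eqF.
Qed.

(* Squares have even entries; [half] reads such vectors modulo 4. *)
Definition half m : 'rV[bool]_n := map_mx (fun z : int => odd `|z|./2%N) m.

Lemma halfD a b : par a = 0 -> par b = 0 -> half (a + b) = half a + half b.
Proof.
move=> /rowP a0 /rowP b0; apply/rowP => j.
have aj : odd `|a 0%R j|%N = false by have := a0 j; rewrite !mxE.
have bj : odd `|b 0%R j|%N = false by have := b0 j; rewrite !mxE.
rewrite !mxE.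
change (odd `|(a 0 j + b 0 j)%R|./2 =
  odd `|a 0%R j|./2 (+) odd `|b 0%R j|./2)%N.
lia.
Qed.

Lemma half_eq0P m : par m = 0 -> reflect (exists c, m = c *+ 4) (half m == 0).
Proof.
move=> /rowP m0; apply: (iffP eqP) => [/rowP h0|[c ->]]; last first.
  have E : c *+ 4 = (c + c) + (c + c) by rewrite (mulrnA c 2 2) !mulr2n.
  apply/rowP => j; rewrite E !mxE; change (odd `|(c 0%R j + c 0%R j +
    (c 0%R j + c 0%R j))%R|./2 = false)%N; lia.
pose c : 'rV[int]_n := \row_j (m 0%R j %/ 4)%Z; exists c.
have -> : c *+ 4 = (c + c) + (c + c) by rewrite (mulrnA c 2 2) !mulr2n.
apply/rowP => j; have mj : odd `|m 0%R j|%N = false by have := m0 j; rewrite !mxE.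
have hj : odd `|m 0%R j|./2%N = false by have := h0 j; rewrite !mxE.
by rewrite !mxE; lia.
Qed.

(* The squaring map from (Z/2)^n to (2Z/4Z)^n. *)
Definition sqmap A v : 'rV[bool]_n := \row_j (v 0 j && ~~ twist A v j).

Lemma half_sq A a : half (bott_mul A a a) = sqmap A (par a).
Proof.
apply/rowP => j; rewrite !mxE; case: (twist A _ j); last by rewrite mul1r; lia.
by rewrite andbF expr1 mulN1r subrr.
Qed.

Lemma par_sq A a : par (bott_mul A a a) = 0.
Proof. by rewrite par_mul addvv. Qed.

Definition lift v : 'rV[int]_n := map_mx (fun b : bool => Posz b) v.

Lemma liftK v : par (lift v) = v.
Proof. by apply/rowP => j; rewrite !mxE; case: (v _ _). Qed.

(** * Reduction of homomorphisms modulo 2 and modulo 4 *)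

Section Hom.
Variables (A B : 'M[bool]_n) (phi : 'rV[int]_n -> 'rV[int]_n).
Hypothesis phiM : forall a b, phi (bott_mul A a b) = bott_mul B (phi a) (phi b).

Let phi0 : phi 0 = 0.
Proof.
have /rowP h : phi 0 = bott_mul B (phi 0) (phi 0) by rewrite -phiM mulb0.
apply/rowP => j; move: (h j); rewrite !mxE; case: (twist _ _ _) => /=; lia.
Qed.

Let phiD a b : par a = 0 -> par (phi a) = 0 -> phi (a + b) = phi a + phi b.
Proof. by move=> a0 pa0; rewrite -(mul_even A) // phiM mul_even. Qed.

(** An even vector is a sum of vectors [2 c_i e_i], each the square of [c_i e_i]. Homomorphisms send
    squares to squares, squares are even, and even vectors compose by plain addition. *)
Lemma par_hom_even a : par a = 0 -> par (phi a) = 0.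
Proof.
move=> /eqP/par_eq0P[c ->]; rewrite (row_sum_delta c) -sumrMnl.
(* Evenness of the partial sums and of their images is carried together, since additivity of [phi]
   at this stage asks for both. *)
suff: par (\sum_i (c 0 i *: delta_mx 0 i) *+ 2) = 0 /\
      par (phi (\sum_i (c 0 i *: delta_mx 0 i) *+ 2)) = 0 by case.
elim/big_ind: _ => [|x y [x0 px0] [y0 py0]|i _].
- by rewrite phi0 par0.
- by rewrite phiD // !parD x0 y0 px0 py0 addr0.
- by rewrite -(mul_delta A) phiM !par_sq.
Qed.

Lemma hom_evenD a b : par a = 0 -> phi (a + b) = phi a + phi b.
Proof. by move=> a0; rewrite phiD ?par_hom_even. Qed.

(** A multiple of 4 is the double of an even vector [2 c]; [phi] is additive there and [phi (2 c)]
    is again even. *)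
Lemma half_hom_even a : par a = 0 -> half a = 0 -> half (phi a) = 0.
Proof.
move=> a0 /eqP /(half_eq0P a0) [c ->]; apply/eqP.
have e : par (c *+ 2) = 0 by rewrite mulr2n parD addvv.
have /eqP/par_eq0P[d dE] := par_hom_even e.
have -> : phi (c *+ 4) = d *+ 4.
  by rewrite (mulrnA c 2 2) mulr2n hom_evenD // dE -mulr2n -mulrnA.
by apply/half_eq0P; [rewrite (mulrnA d 2 2) mulr2n parD addvv | exists d].
Qed.

Definition hom_mod2 v := par (phi (lift v)).

(** The map on (Z/2)^n does not depend on the representative: [a] and [lift (par a)] differ by an
    even vector, whose image is even. *)
Lemma hom_mod2E a : hom_mod2 (par a) = par (phi a).
Proof.
have -> : phi a = phi (a - lift (par a)) + phi (lift (par a)).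
  by rewrite -hom_evenD ?subrK // parD parN liftK addvv.
by rewrite parD par_hom_even ?add0r // parD parN liftK addvv.
Qed.

Lemma hom_mod2D u v : hom_mod2 (u + v) = hom_mod2 u + hom_mod2 v.
Proof.
rewrite -[in LHS](liftK u) -[in LHS](liftK v) -(par_mul A) hom_mod2E phiM.
by rewrite par_mul.
Qed.

Lemma sqmap_hom v :
  sqmap B (hom_mod2 v) = half (phi (bott_mul A (lift v) (lift v))).
Proof. by rewrite phiM half_sq. Qed.

End Hom.

(** * Invariance of the two numbers under isomorphism *)

Section Iso.
Variables (A B : 'M[bool]_n) (phi psi : 'rV[int]_n -> 'rV[int]_n).
Variable tau : 'rV[int]_n.
Hypothesis phiM : forall a b, phi (bott_mul A a b) = bott_mul B (phi a) (phi b).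
Hypothesis psiM : forall a b, psi (bott_mul B a b) = bott_mul A (psi a) (psi b).
(** Lifts of a map and of its inverse compose to a deck transformation [tau], not to the identity,
    so [psi \o phi] is only conjugation by [tau]. *)
Hypothesis psiphi : forall a, bott_mul A (psi (phi a)) tau = bott_mul A tau a.

(** Conjugating an even vector by [tau] changes only signs of its entries, and an even integer
    equals its opposite modulo 4. *)
Let half_eq0 a : par a = 0 -> (half (phi a) == 0) = (half a == 0).
Proof.
move=> a0; apply/eqP/eqP => [h0|]; last exact: (half_hom_even phiM).
have pa0 := par_hom_even phiM a0.
have ppa0 := par_hom_even psiM pa0.
have hpp := half_hom_even psiM pa0 h0.
have := psiphi a; rewrite (mul_even _ _ ppa0) => /rowP E.
apply/rowP => j; move/rowP: hpp => /(_ j); move: (E j).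
by rewrite !mxE; case: (twist _ _ _) => /=; rewrite ?mulN1r ?mul1r; lia.
Qed.

Let half_eq a b : par a = 0 -> par b = 0 ->
  (half (phi a) == half (phi b)) = (half a == half b).
Proof.
have sub0 x y : (x == y) = (x + y == 0 :> 'rV[bool]_n).
  apply/eqP/eqP => [->|/(congr1 (+%R^~ y))]; first exact: addvv.
  by rewrite -addrA addvv addr0 add0r.
move=> a0 b0; rewrite sub0 [RHS]sub0 -!halfD ?par_hom_even //; first last.
- exact: (par_hom_even phiM).
- exact: (par_hom_even phiM).
by rewrite -(hom_evenD phiM) // half_eq0 // parD a0 b0 addr0.
Qed.

Lemma sqmap_hom_eq u v : (sqmap B (hom_mod2 phi u) == sqmap B (hom_mod2 phi v))
  = (sqmap A u == sqmap A v).
Proof. by rewrite !(sqmap_hom phiM) half_eq ?par_sq // !half_sq !liftK. Qed.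

Lemma sqmap_hom_eqD u v w :
  (sqmap B (hom_mod2 phi u) + sqmap B (hom_mod2 phi v)
     == sqmap B (hom_mod2 phi w))
  = (sqmap A u + sqmap A v == sqmap A w).
Proof.
rewrite !(sqmap_hom phiM) -halfD ?(par_hom_even phiM) ?par_sq //.
rewrite -(hom_evenD phiM) ?par_sq // half_eq ?parD ?par_sq ?addr0 //.
by rewrite halfD ?par_sq // !half_sq !liftK.
Qed.

(** Conjugation by [tau] is trivial on the abelian quotient (Z/2)^n, so [hom_mod2 psi] is a left
    inverse. *)
Lemma hom_mod2_inj : injective (hom_mod2 phi).
Proof.
apply: (can_inj (g := hom_mod2 psi)) => v.
rewrite (hom_mod2E psiM) -{2}(liftK v).
have := congr1 par (psiphi (lift v)); rewrite !par_mul addrC.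
by move/addrI.
Qed.

Definition sq_fibers A := (\sum_v (\sum_u (sqmap A u == sqmap A v : nat)) ^ 2)%N.
Definition sq_additive A :=
  (\sum_u \sum_v (sqmap A u + sqmap A v == sqmap A (u + v))%R)%N.

Lemma sq_fibers_iso : sq_fibers A = sq_fibers B.
Proof.
rewrite /sq_fibers [RHS](reindex_inj hom_mod2_inj); apply: eq_bigr => v _.
rewrite [in RHS](reindex_inj hom_mod2_inj); congr (_ ^ 2)%N.
by apply: eq_bigr => u _; rewrite sqmap_hom_eq.
Qed.

Lemma sq_additive_iso : sq_additive A = sq_additive B.
Proof.
rewrite /sq_additive [RHS](reindex_inj hom_mod2_inj); apply: eq_bigr => u _.
rewrite [in RHS](reindex_inj hom_mod2_inj); apply: eq_bigr => v _.
by rewrite -(hom_mod2D phiM) sqmap_hom_eqD.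
Qed.

End Iso.
End BottGroup.

(** * The universal covering *)

Section SupNorm.
Local Open Scope ring_scope.
Variables (R : realType) (n : nat).
Implicit Types x y : 'rV[R]_n.

Lemma rV_norm_leP x (e : R) : 0 <= e ->
  reflect (forall j, `|x 0 j| <= e) (`|x| <= e).
Proof.
move=> e0; rewrite [`|x|]/Num.Def.normr/= mx_normrE.
apply: (iffP (bigmax_leP _ _ _ _)) => [[_ xe] j|xe]; first exact: (xe (0, j)).
by split=> // -[i j] _; rewrite ord1 xe.
Qed.

Lemma rV_norm_ltP x (e : R) : 0 < e ->
  reflect (forall j, `|x 0 j| < e) (`|x| < e).
Proof.
move=> e0; rewrite [`|x|]/Num.Def.normr/= mx_normrE.
apply: (iffP (bigmax_ltP _ _ _ _)) => [[_ xe] j|xe]; first exact: (xe (0, j)).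
by split=> // -[i j] _; rewrite ord1 xe.
Qed.

Lemma rV_coord_le x j : `|x 0 j| <= `|x|.
Proof. by have /rV_norm_leP := lexx `|x|; apply. Qed.

End SupNorm.

Section BottAction.
Local Open Scope ring_scope.
Variables (R : realType) (n : nat) (A : 'M[bool]_n).
Implicit Types (a b m : 'rV[int]_n) (x y : 'rV[R]_n).

Definition act m x : 'rV[R]_n :=
  \row_j ((-1) ^+ twist A (par m) j * x 0 j + (m 0 j)%:~R * pi).

Lemma act_mul a b x : act (bott_mul A a b) x = act a (act b x).
Proof.
apply/rowP => j; rewrite !mxE par_mul twistD.
rewrite [X in _ ^+ (nat_of_bool X)]
  (_ : _ = twist A (par a) j (+) twist A (par b) j) //.
rewrite signr_addb rmorphD rmorphM rmorph_sign /=.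
by move: (pi : R) => t; rewrite mulrDl mulrDr !mulrA addrAC addrA.
Qed.

Lemma act0 x : act 0 x = x.
Proof. by apply/rowP => j; rewrite !mxE par0 twist0 mul1r mul0r addr0. Qed.

Definition bott_inv m : 'rV[int]_n :=
  \row_j (- ((-1) ^+ twist A (par m) j * m 0 j)).

Lemma par_inv m : par (bott_inv m) = par m.
Proof.
by apply/rowP => j; rewrite !mxE abszN abszM abszX /= exp1n mul1n.
Qed.

Lemma bott_mulVl m : bott_mul A (bott_inv m) m = 0.
Proof. by apply/rowP => j; rewrite !mxE par_inv addNr. Qed.

Lemma actK m : cancel (act m) (act (bott_inv m)).
Proof. by move=> x; rewrite -act_mul bott_mulVl act0. Qed.

Lemma act_dist m x y : `|act m x - act m y| = `|x - y|.
Proof.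
have le z t : `|act m z - act m t| <= `|z - t|.
  apply/rV_norm_leP => // j; apply: le_trans (rV_coord_le _ j); rewrite !mxE.
  by rewrite opprD addrACA subrr addr0 -mulrBr normrMsign.
apply/le_anti; rewrite le /=.
apply/rV_norm_leP => // j; apply: le_trans (rV_coord_le _ j); rewrite !mxE.
by rewrite opprD addrACA subrr addr0 -mulrBr normrMsign.
Qed.

(* At the first index where [a] and [b] differ the signs agree, so the images
   differ there by a nonzero multiple of [pi]. *)
Lemma act_sep a b x : `|act a x - act b x| < pi -> a = b.
Proof.
move=> /rV_norm_ltP-/(_ (pi_gt0 R)) d; apply/rowP.
suff H k : forall j : 'I_n, (j < k)%N -> a 0 j = b 0 j.
  by move=> j; apply: (H j.+1).
elim: k => // k IH j; rewrite ltnS => jk.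
have tE : twist A (par a) j = twist A (par b) j.
  by apply: eq_bigr => i /andP[ij _]; rewrite !mxE IH // (leq_trans ij).
move: (d j); rewrite !mxE tE opprD addrACA subrr add0r -mulrBl normrM.
rewrite (gtr0_norm (pi_gt0 R)) gtr_pMl ?pi_gt0 // -rmorphB /= -intr_norm.
by rewrite -[1]/(1%:~R) ltr_int; lia.
Qed.

Lemma act_inj a b x : act a x = act b x -> a = b.
Proof. by move=> E; apply: (@act_sep _ _ x); rewrite E subrr normr0 pi_gt0. Qed.

Lemma act_even m x : par m = 0 -> act m x = x + \row_j ((m 0 j)%:~R * pi).
Proof. by move=> m0; apply/rowP => j; rewrite !mxE m0 twist0 mul1r. Qed.

End BottAction.

Lemma twist_delta n (A : 'M[bool]_n) i j :
  twist A (par (delta_mx 0%R i)) j = (i < j)%N && A i j.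
Proof.
rewrite /twist; case: (boolP ((i < j)%N && A i j)) => ij.
  rewrite (bigD1 i) //= big1 ?addr0; first by rewrite !mxE !eqxx.
  by move=> k /andP[_ ki]; rewrite !mxE (negbTE ki).
rewrite big1 // => k kj; rewrite !mxE; case: (eqVneq k i) kj ij => [->|//].
by move=> ->.
Qed.

(** * The manifold as the orbit space of the deck group *)

Section BottProjection.
Local Open Scope ring_scope.
Variables (R : realType) (n : nat) (A : 'M[bool]_n).
Implicit Types (a b m : 'rV[int]_n) (x y : 'rV[R]_n).

(** Removing full turns leaves an angle in [0, 2 pi). Cosine is injective on [0, pi]; an angle [s]
    beyond pi is replaced by [2 pi - s], which would then vanish. *)
Lemma cos_eq1 (t : R) : cos t = 1 -> exists k : int, t = k%:~R * (pi *+ 2).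
Proof.
move=> ct; have tpi0 : 0 < pi *+ 2 :> R by rewrite pmulrn_rgt0 ?pi_gt0.
pose k := Num.floor (t / (pi *+ 2)); exists k.
have perN (l : int) (u : R) : cos (u + l%:~R * (pi *+ 2)) = cos u.
  have H (i : nat) (v : R) : cos (v + i%:~R * (pi *+ 2)) = cos v.
    by rewrite mulrzl -pmulrn (periodicn (@cosD2pi R)).
  case: l => [i|i]; first exact: H.
  by rewrite NegzE rmorphN mulNr -[LHS](H i.+1) -addrA addNr addr0.
pose s := t - k%:~R * (pi *+ 2).
have cs : cos s = 1.
  by rewrite /s -mulNr -rmorphN perN.
have /andP[s0 s2] : 0 <= s < pi *+ 2.
  have /andP[] := floor_itv (t / (pi *+ 2)); rewrite -/k.
  rewrite ler_pdivlMr // ltr_pdivrMr // => h1 h2.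
  rewrite subr_ge0 h1 /=; move: h2; rewrite rmorphD mulrDl mul1r /s; lra.
suff s00 : s = 0 by rewrite -[LHS](subrK (k%:~R * (pi *+ 2))) -/s s00 add0r.
have [sp|sp] := leP s pi.
  by apply: cos_inj; rewrite ?cs ?cos0 // in_itv /= ?lexx ?s0 ?pi_ge0.
have : pi *+ 2 - s = 0.
  apply: cos_inj; rewrite ?cos0 ?in_itv /= ?lexx ?pi_ge0 //.
    by move: sp s2; rewrite !mulr2n => *; apply/andP; split; lra.
  by rewrite cosB cos2pi sin2pi mul0r addr0 mul1r.
lra.
Qed.

Lemma torus_expP x y : torus_exp x = torus_exp y <->
  exists c : 'rV[int]_n, y = x + \row_j ((c 0 j)%:~R * (pi *+ 2)).
Proof.
split=> [E|[c ->]]; last first.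
  apply/val_inj/rowP => j; rewrite !mxE.
  have H (i : nat) (v : R) : (cos (v + i%:~R * (pi *+ 2)) = cos v :> R) *
     (sin (v + i%:~R * (pi *+ 2)) = sin v :> R).
    rewrite mulrzl -pmulrn (periodicn (@cosD2pi R)).
    by rewrite (periodicn (@sinD2pi R)).
  case: (c 0 j) => i; first by rewrite !H.
  rewrite NegzE rmorphN mulNr.
  rewrite -[in RHS](H i.+1 (_ - _)).1 -[in RHS](H i.+1 (_ - _)).2.
  by rewrite -addrA addNr addr0.
have E' j : exists k : int, y 0 j - x 0 j = k%:~R * (pi *+ 2).
  (* Points with equal cosines and sines satisfy [cos (y - x) = cos ^ 2 + sin ^ 2 = 1]. *)
  apply: cos_eq1; have /rowP/(_ j) := congr1 val E; rewrite !mxE => -[c s].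
  by rewrite cosB -c -s -!expr2 cos2Dsin2.
exists (\row_j xget 0 [set k : int | y 0 j - x 0 j = k%:~R * (pi *+ 2)]%classic).
apply/rowP => j; rewrite !mxE; case: xgetP => [k -> /= kE|].
  by rewrite -kE; ring.
by have [k kE] := E' j => /(_ k).
Qed.

Lemma sin_cos_angle (u v : R) : u ^+ 2 + v ^+ 2 = 1 ->
  exists t, cos t = u /\ sin t = v.
Proof.
move=> uv; have u1 : -1 <= u <= 1 by apply/andP; split; nra.
have ca : cos (acos u) = u by rewrite acosK.
have sa : sin (acos u) = `|v|.
  by rewrite sin_acos // -sqrtr_sqr; congr Num.sqrt; rewrite -uv addrC addKr.
have [v0|v0] := leP 0 v; [exists (acos u) | exists (- acos u)].
  by rewrite ca sa ger0_norm.
by rewrite cosN sinN ca sa ltr0_norm ?opprK.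
Qed.

Lemma torus_exp_surj (z : torus R n) : exists x, torus_exp x = z.
Proof.
have H j : exists t : R,
    cos t = complex.Re (val z 0 j) /\ sin t = complex.Im (val z 0 j).
  apply: sin_cos_angle; have /forallP/(_ j)/eqP := valP z.
  case: (val z _ j) => u v /=; rewrite normc_def /=.
  move=> -[] /(congr1 (fun t => t ^+ 2)).
  by rewrite expr1n sqr_sqrtr // addr_ge0 ?sqr_ge0.
exists (\row_j xget 0 [set t |
  cos t = complex.Re (val z 0 j) /\ sin t = complex.Im (val z 0 j)]%classic).
apply/val_inj/rowP => j; rewrite !mxE; case: xgetP => [t _ [-> ->]|].
  by case: (val z 0 j).
by have [t] := H j => tE /(_ t) [].
Qed.

Lemma real_bott_proj_surj (z : real_bott R A) : exists x, real_bott_proj A x = z.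
Proof.
have [x xE] := torus_exp_surj (generic_quotient.repr z); exists x.
by rewrite /real_bott_proj xE reprK.
Qed.

Lemma torus_exp_gen i x :
  bott_gen A i (torus_exp x) = torus_exp (act A (delta_mx 0 i) x).
Proof.
have sgn (b : bool) (t : R) : cos ((-1) ^+ b * t) = cos t /\
    sin ((-1) ^+ b * t) = (-1) ^+ b * sin t.
  by case: b; rewrite ?expr1 ?mulN1r ?cosN ?sinN // !mul1r.
apply/val_inj/rowP => j; rewrite !mxE /= twist_delta.
case: (eqVneq j i) => [->|ji] /=.
  rewrite ltnn /= mul1r mul1r cosDpi sinDpi.
  by simpc.
rewrite mul0r addr0; case: ifP => _ /=; last by rewrite mul1r.
by rewrite mulN1r cosN sinN.
Qed.

(** A word in the generators of the torus action lifts to some [act A m], where the parity of [m]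
    counts the letters. Two elements of equal parity differ by an even translation, which
    [torus_exp] does not see. *)
Lemma real_bott_projP x y :
  real_bott_proj A x = real_bott_proj A y <-> exists m, y = act A m x.
Proof.
have foldE s x0 : exists m, foldr (bott_gen A) (torus_exp x0) s =
    torus_exp (act A m x0) /\ par m = \row_j odd (count_mem j s).
  elim: s => [|i s [m [IH pm]]] /=.
    by exists 0; rewrite act0 par0; split=> //; apply/rowP => j; rewrite !mxE.
  exists (bott_mul A (delta_mx 0 i) m); split.
    by rewrite IH torus_exp_gen act_mul.
  rewrite par_mul pm; apply/rowP => j; rewrite !mxE oddD eq_sym.
  by case: (eqVneq i j).
split=> [/eqquotP/asboolP[s]|[m ->]].
  have [m [-> _]] := foldE s x => /esym/torus_expP[c ->].
  exists (bott_mul A (c *+ 2) m); rewrite act_mul [RHS]act_even; last first.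
    by rewrite mulr2n parD addvv.
  congr (_ + _); apply/rowP => j; rewrite [c *+ 2]mulr2n !mxE rmorphD /=; ring.
(* The word uses each generator whose coordinate in [m] is odd exactly once, so its lift has the
   parity of [m]. *)
apply/eqquotP/asboolP; exists [seq i <- enum 'I_n | odd `|m 0 i|].
have us := filter_uniq (fun i => odd `|m 0%R i|%N) (enum_uniq 'I_n).
have [m' [-> pm']] := foldE [seq i <- enum 'I_n | odd `|m 0%R i|%N] x.
have pE : par m' = par m.
  rewrite pm'; apply/rowP => j; rewrite !mxE (count_uniq_mem _ us).
  by rewrite mem_filter mem_enum andbT oddb.
have /eqP/par_eq0P[c cE] : par (m - m') = 0 by rewrite parD parN pE addvv.
have mE : m = bott_mul A (c + c) m'.
  by rewrite mul_even ?parD ?addvv // -mulr2n -cE subrK.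
apply/esym/torus_expP; exists c; rewrite mE act_mul.
rewrite [LHS](@act_even _ _ A (c + c)); last by rewrite parD addvv.
congr (_ + _); apply/rowP => j; rewrite !mxE rmorphD /=.
by move: (pi : R) => t; rewrite mulr2n mulrDr mulrDl.
Qed.

End BottProjection.

(** * Lifting diffeomorphisms to the universal covering *)

Section Clamp.
Local Open Scope ring_scope.
Variables (R : realType) (n : nat).
Implicit Types (t s : R) (x y : 'rV[R]_n).

(** The coordinatewise retraction onto the cube of radius [t]. As [t] grows from 0 it undoes a
    contraction of R^n to the origin, and the Lipschitz bounds in [x] and in [t] make this
    uniform. *)
Definition clamp t x : 'rV[R]_n := \row_j Num.max (- t) (Num.min t (x 0 j)).

Let clampE t (a : R) : 0 <= t -> let c := Num.max (- t) (Num.min t a) in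
  [\/ a <= - t /\ c = - t, - t <= a <= t /\ c = a | t <= a /\ c = t].
Proof.
move=> t0 /=; case: (leP t a) => ta; last case: (leP (- t) a) => ta'.
- by apply: Or33; split=> //; apply/max_idPr; lra.
- by apply: Or32; split=> //; apply/andP; split=> //; apply: ltW.
- by apply: Or31; split=> //; apply: ltW.
Qed.

Lemma clamp0 x : clamp 0 x = 0.
Proof.
by apply/rowP => j; rewrite !mxE; have [] := clampE (x 0 j) (lexx 0); lra.
Qed.

Lemma clamp_id t x : `|x| <= t -> clamp t x = x.
Proof.
move=> xt; apply/rowP => j; have := le_trans (rV_coord_le x j) xt.
have := clampE (x 0 j) (le_trans (normr_ge0 x) xt).
by rewrite mxE ler_norml => -[] [] + -> /andP[]; lra.
Qed.

Lemma clamp_lip t x y : 0 <= t -> `|clamp t x - clamp t y| <= `|x - y|.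
Proof.
move=> t0; apply/rV_norm_leP => // j; apply: le_trans (rV_coord_le (x - y) j).
rewrite !mxE; have := ler_norm (x 0 j - y 0 j); have := ler_norm (y 0 j - x 0 j).
rewrite distrC ler_norml; move: (`|x 0 j - y 0 j|) => c ? ?.
have [] := clampE (x 0 j) t0; have [] := clampE (y 0 j) t0 => -[? ->] [? ->];
  by apply/andP; split; lra.
Qed.

Lemma clamp_step t s x : 0 <= t -> 0 <= s -> `|clamp t x - clamp (t + s) x| <= s.
Proof.
move=> t0 s0; apply/rV_norm_leP => // j; rewrite !mxE ler_norml.
have [] := clampE (x 0 j) t0; have [] := clampE (x 0 j) (addr_ge0 t0 s0)
  => -[? ->] [? ->]; by apply/andP; split; lra.
Qed.

End Clamp.

Section Lifting.
Local Open Scope ring_scope.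
Variables (R : realType) (n p : nat) (N : Type).
Variables (q : 'rV[R]_p -> N) (g : 'rV[R]_n -> N) (d e r : R) (u0 : 'rV[R]_p).
Hypothesis q_sep : forall u v, q u = q v -> `|u - v| < d -> u = v.
(** Neighbouring lifts are compared along a chain of four steps, each shorter than [e]; the chain
    must stay below the separation [d] of a fibre. *)
Hypothesis ed : 4 * e <= d.
Hypothesis r_gt0 : 0 < r.
Hypothesis g_close : forall x y, `|x - y| < r ->
  forall u, q u = g x -> exists2 v, q v = g y & `|u - v| < e.
Hypothesis q_u0 : q u0 = g 0.

(** Half of [r], so that one enlargement of the cube moves points by strictly less than [r]. *)
Let s := r / 2.
Let s_ge0 : 0 <= s. Proof. by rewrite divr_ge0 // ltW. Qed.
Let ks_ge0 (k : nat) : 0 <= k%:R * s. Proof. by rewrite mulr_ge0. Qed.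

(* The lift of [g \o clamp (k * s)] : successive clamps are uniformly close, so
   each lift determines the next one pointwise. *)
Fixpoint lift_upto (k : nat) (x : 'rV[R]_n) : 'rV[R]_p :=
  if k is k'.+1 then
    xget 0 [set v | q v = g (clamp (k%:R * s) x) /\
                    `|lift_upto k' x - v| < e]%classic
  else u0.

Let lift_uptoP k x : q (lift_upto k x) = g (clamp (k%:R * s) x) /\
  `|lift_upto k x - lift_upto k.+1 x| < e.
Proof.
have step m : q (lift_upto m x) = g (clamp (m%:R * s) x) ->
    q (lift_upto m.+1 x) = g (clamp (m.+1%:R * s) x) /\
    `|lift_upto m x - lift_upto m.+1 x| < e.
  move=> IH; apply: (@xgetPex _ 0
    [set v | q v = g (clamp (m.+1%:R * s) x) /\ `|lift_upto m x - v| < e]%classic).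
  have -> : m.+1%:R * s = m%:R * s + s by rewrite -natr1 mulrDl mul1r.
  have lt : `|clamp (m%:R * s) x - clamp (m%:R * s + s) x| < r.
    apply: le_lt_trans (clamp_step _ _ _) _ => //.
    by rewrite ltr_pdivrMr //; move: r_gt0; lra.
  by have [v qv uv] := g_close lt IH; exists v.
have qk : q (lift_upto k x) = g (clamp (k%:R * s) x).
  by elim: k => [|k /step[]//]; rewrite mul0r clamp0.
by split=> //; have [] := step _ qk.
Qed.

Let e_gt0 : 0 < e.
Proof. by apply: le_lt_trans (lift_uptoP 0 0).2. Qed.

(** Closeness propagates from stage [k] to [k.+1]. The point [v] over the clamp of [y] near the lift
    of [x], and the lift of [y], lie in one fibre; the chain through both lifts at stage [k] shows
    that they coincide. *)
Let lift_upto_close k x y : `|x - y| < r -> `|lift_upto k x - lift_upto k y| < e.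
Proof.
move=> xy; elim: k => [|k IH]; first by rewrite /= subrr normr0.
have cxy : `|clamp (k.+1%:R * s) x - clamp (k.+1%:R * s) y| < r.
  by apply: le_lt_trans (clamp_lip _ _ _) xy.
have [v qv xv] := g_close cxy (lift_uptoP k.+1 x).1.
suff -> : lift_upto k.+1 y = v by [].
apply: q_sep; first by rewrite qv (lift_uptoP _ _).1.
have h1 := (lift_uptoP k x).2; have h2 := (lift_uptoP k y).2.
have -> : lift_upto k.+1 y - v = - (lift_upto k y - lift_upto k.+1 y) -
   (lift_upto k x - lift_upto k y) + (lift_upto k x - lift_upto k.+1 x) +
   (lift_upto k.+1 x - v).
  by apply/rowP => j; rewrite !mxE; ring.
have tri (a b c f : 'rV[R]_p) :
    `|a + b + c + f| <= `|a| + `|b| + `|c| + `|f|.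
  rewrite (le_trans (ler_normD _ _)) // lerD2r.
  by rewrite (le_trans (ler_normD _ _)) // lerD2r ler_normD.
apply: lt_le_trans ed; apply: le_lt_trans (tri _ _ _ _) _.
rewrite !normrN; move: h1 h2 IH xv.
by move: `|_| `|_| `|_| `|_| => a1 a2 a3 a4; lra.
Qed.

(** Once the cube contains [x] the clamp fixes it, so consecutive lifts lie in one fibre at distance
    below [e] and agree. *)
Let lift_upto_stable k l x : `|x| <= k%:R * s -> (k <= l)%N ->
  lift_upto l x = lift_upto k x.
Proof.
move=> xk; elim: l => [|l IH]; first by rewrite leqn0 => /eqP ->.
rewrite leq_eqVlt ltnS => /predU1P[<- //|kl]; rewrite -IH //.
have xl : `|x| <= l%:R * s by apply: le_trans xk _; rewrite ler_wpM2r ?ler_nat.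
have xl1 : `|x| <= l.+1%:R * s by apply: le_trans xl _; rewrite ler_wpM2r ?ler_nat.
apply/esym/q_sep.
  by rewrite (lift_uptoP _ _).1 (lift_uptoP _ _).1 !clamp_id.
by apply: lt_le_trans (lift_uptoP _ _).2 _; move: e_gt0 ed; lra.
Qed.

Lemma uniform_lift : exists F : 'rV[R]_n -> 'rV[R]_p,
  (forall x, q (F x) = g x) /\
  (forall x y, `|x - y| < r -> `|F x - F y| < e).
Proof.
have s_gt0 : 0 < s by rewrite divr_gt0.
pose K (x : 'rV[R]_n) := (Num.trunc (`|x| / s)).+1.
have xK (x : 'rV[R]_n) : `|x| <= (K x)%:R * s.
  rewrite -ler_pdivrMr // ltW //.
  by have /andP[] := truncn_itv (divr_ge0 (normr_ge0 x) s_ge0).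
exists (fun x => lift_upto (K x) x); split=> [x|x y xy].
  by rewrite (lift_uptoP _ _).1 clamp_id.
(* Both points are moved to a common stage, the larger of their two, where closeness has been
   proved. *)
rewrite -(lift_upto_stable (xK x) (leq_maxl _ (K y))).
rewrite -(lift_upto_stable (xK y) (leq_maxr (K x) _)).
exact: lift_upto_close.
Qed.

End Lifting.

(** * Uniform continuity of local lifts *)

Section UniformCloseness.
Local Open Scope classical_set_scope.
Local Open Scope ring_scope.
Variables (R : realType) (n : nat) (A B : 'M[bool]_n).
Variable f : real_bott R A -> real_bott R B.
Hypothesis smooth_f :
  smooth_map (@real_bott_atlas R n A) (@real_bott_atlas R n B) f.
Implicit Types (x y u v : 'rV[R]_n) (e : R).
Local Notation pA := (@real_bott_proj R n A).
Local Notation pB := (@real_bott_proj R n B).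

(** Charts of the quotient atlas are local inverses of the projections, so the local expression [g]
    of [f] is itself a lift. The deck element [a] first carries [x] into the domain [V] of the
    chart. *)
Lemma smooth_map_local_lift x e : 0 < e -> exists2 r : R, 0 < r &
  exists h : 'rV[R]_n -> 'rV[R]_n, forall y, `|x - y| < r ->
    pB (h y) = f (pA y) /\ `|h x - h y| < e.
Proof.
move=> e0; have [c [d [[V [oV iV cdom cK]] [W [_ _ ddom dK]] cx sub [g sg gE]]]] :=
  smooth_f (pA x).
move: cx; rewrite cdom => -[v Vv /real_bott_projP[m xE]].
have gc : {for v, continuous g}.
  apply: (sg 0%N); exists (pA v); last by rewrite cK // inE.
  by rewrite cdom; exists v.
have /nbhs_ballP[r1 /= r1_gt0 r1V] : nbhs v V by apply: open_nbhs_nbhs.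
have /nbhs_ballP[r2 /= r2_gt0 r2g] := gc _ (nbhsx_ballx (g v) _ e0).
exists (Num.min r1 r2); first by rewrite lt_min r1_gt0.
pose a := bott_inv A m; exists (g \o act A a) => y.
have av : act A a x = v by rewrite xE actK.
rewrite -(act_dist A a) av lt_min => /andP[yr1 yr2] /=; split; last first.
  by have := r2g (act A a y); rewrite -!ball_normE /= av; apply.
have Vy : V (act A a y) by apply: r1V; rewrite -ball_normE.
have pay : pA (act A a y) = pA y.
  by apply/esym/real_bott_projP; exists a.
have dy : chart_dom c (pA (act A a y)) by rewrite cdom; exists (act A a y).
rewrite -{1}(cK (act A a y)) ?inE // gE // pay.
have : chart_dom d (f (pA y)) by apply: sub; exists (pA y); rewrite -?pay.
by rewrite ddom => -[w Ww <-]; rewrite dK // inE.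
Qed.

Definition lift_close e r x := forall y, `|x - y| < r ->
  forall u, pB u = f (pA x) -> exists2 v, pB v = f (pA y) & `|u - v| < e.

(** Any lift [u] of the value at [y] is a deck translate of [h y]. Deck transformations are
    isometries, so the same translate of [h z] is a lift near [u]. *)
Lemma lift_close_local x e : 0 < e ->
  exists2 r : R, 0 < r & forall y, `|x - y| < r -> lift_close e r y.
Proof.
move=> e0; have [|r r0 [h hE]] := @smooth_map_local_lift x (e / 2).
  by rewrite divr_gt0.
exists (r / 2); first by rewrite divr_gt0.
move=> y xy z yz u pu.
have [pz hz] : pB (h z) = f (pA z) /\ `|h x - h z| < e / 2.
  by apply: hE; rewrite (splitr r) -(subrKA y) (le_lt_trans (ler_normD _ _)) ?ltrD.
have [py hy] : pB (h y) = f (pA y) /\ `|h x - h y| < e / 2.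
  by apply: hE; apply: lt_le_trans xy _; move: r0; lra.
have /real_bott_projP[m ->] : pB (h y) = pB u by rewrite py pu.
exists (act B m (h z)).
  by rewrite -pz; apply/esym/real_bott_projP; exists m.
rewrite act_dist (splitr e) -(subrKA (h x)) (le_lt_trans (ler_normD _ _)) //.
by rewrite ltrD // distrC.
Qed.

(* Lebesgue number of a compact fundamental cube, spread by the deck group. *)
Lemma lift_close_uniform e : 0 < e ->
  exists2 r : R, 0 < r & forall x, lift_close e r x.
Proof.
move=> e0.
pose K := [set x : 'rV[R]_n | forall j, `[0, pi *+ 2]%classic (x ord0 j)].
have cptK : compact K.
  apply: (@rV_compact _ _ (fun=> `[0, pi *+ 2]%classic)) => _.
  exact: segment_compact.
have cover x : K x ->
    (\forall y \near x & r \near (0 : R)^'+, lift_close e r y)%classic.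
  move=> _; have [r r0 rP] := lift_close_local x e0.
  exists (ball x r, [set s | s < r])%classic => /=.
    by split; [exact: nbhsx_ballx | exact: nbhs_right_lt].
  move=> [y s] [/=]; rewrite -ball_normE /= => xy sr z yz.
  exact: (rP y xy z (lt_trans yz sr)).
have near_r := (compact_near_coveringP K).1 cptK _ _ _ _ cover.
near (0 : R)^'+ => r; exists r; first by near: r; exact: nbhs_right_gt.
have KP : (K `<=` lift_close e r)%classic by near: r; exact: near_r.
move=> x y xy u pu.
(* An even element, hence a pure translation; it subtracts from each coordinate its whole number of
   full turns and lands in the cube [K]. *)
pose m : 'rV[int]_n := - ((\row_j Num.floor (x 0 j / (pi *+ 2))) *+ 2).
have m0 : par m = 0 by rewrite parN mulr2n parD addvv.
have Kx : K (act A m x).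
  move=> j; have tpi0 : 0 < pi *+ 2 :> R by rewrite pmulrn_rgt0 ?pi_gt0.
  have /andP[] := floor_itv (x 0 j / (pi *+ 2)).
  rewrite ler_pdivlMr // ltr_pdivrMr // act_even // /m (mulr2n (\row_j _)) !mxE.
  move: (Num.floor _) => k; rewrite opprD !rmorphD !rmorphN /= in_itv /= !mulr2n.
  by move=> h1 h2; apply/andP; split; lra.
have [||v pv uv] := KP _ Kx (act A m y) _ u; first by rewrite act_dist.
  by rewrite pu; congr f; apply/real_bott_projP; exists m.
exists v => //; rewrite pv; congr f; apply/esym/real_bott_projP; by exists m.
Unshelve. all: by end_near. Qed.

End UniformCloseness.

(** * The isomorphism of deck groups induced by a diffeomorphism *)

Section DeckGroup.
Local Open Scope classical_set_scope.
Local Open Scope ring_scope.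
Variables (R : realType) (n : nat).
Implicit Types (A B : 'M[bool]_n) (x y : 'rV[R]_n).
Local Notation proj A := (@real_bott_proj R n A).

(** The segment from 0 to [x] is cut into [N] equal steps shorter than [r]. *)
Lemma uniformly_locally_constant (T : Type) (c : 'rV[R]_n -> T) (r : R) :
  0 < r -> (forall x y, `|x - y| < r -> c x = c y) -> forall x, c x = c 0.
Proof.
move=> r0 cE x; pose N := (Num.trunc (`|x| / r)).+1.
have xN : `|x| < N%:R * r.
  rewrite -ltr_pdivrMr //.
  by have /andP[] := truncn_itv (divr_ge0 (normr_ge0 x) (ltW r0)).
have H k : c ((k%:R / N%:R) *: x) = c 0.
  elim: k => [|k <-]; first by rewrite mul0r scale0r.
  apply: cE; rewrite -scalerBl normrZ -mulrBl -natr1 addrAC subrr add0r mul1r.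
  by rewrite ger0_norm ?invr_ge0 // mulrC ltr_pdivrMr // mulrC.
by rewrite -(H N) divff ?scale1r // pnatr_eq0.
Qed.

Lemma lift_diffeo A B (f : real_bott R A -> real_bott R B) (e : R) :
  smooth_map (@real_bott_atlas R n A) (@real_bott_atlas R n B) f ->
  0 < e -> 4 * e <= pi ->
  exists2 r : R, 0 < r & exists F : 'rV[R]_n -> 'rV[R]_n,
    (forall x, proj B (F x) = f (proj A x)) /\
    (forall x y, `|x - y| < r -> `|F x - F y| < e).
Proof.
move=> sf e0 epi; have [r r0 close] := lift_close_uniform sf e0.
have [u0 pu0] := real_bott_proj_surj (f (proj A 0)).
exists r => //; apply: (@uniform_lift _ _ _ _ _ _ pi _ _ u0) => //.
move=> u v /real_bott_projP[m ->]; rewrite -{1}(act0 B u) => /act_sep <-.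
by rewrite act0.
Qed.

(** A suitable deck element [c x] exists at each point. For nearby [x] and [y], [c x] and [c y] move
    [F y] to points less than [2 e] apart, while distinct deck elements move any point at least [pi]
    apart; so [c] is constant. *)
Lemma deck_equivariant A B (f : real_bott R A -> real_bott R B)
    (F : 'rV[R]_n -> 'rV[R]_n) (e r : R) : 0 < r -> 4 * e <= pi ->
  (forall x, proj B (F x) = f (proj A x)) ->
  (forall x y, `|x - y| < r -> `|F x - F y| < e) ->
  forall m, exists a, forall x, F (act A m x) = act B a (F x).
Proof.
move=> r0 epi FE Fr m.
have ex x : exists a, F (act A m x) = act B a (F x).
  apply/real_bott_projP; rewrite !FE; congr f.
  by apply/real_bott_projP; exists m.
pose c x := xget 0 [set a | F (act A m x) = act B a (F x)].
have cP x : F (act A m x) = act B (c x) (F x).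
  exact: (@xgetPex _ 0 [set a | F (act A m x) = act B a (F x)] (ex x)).
exists (c 0) => x; rewrite cP; congr act.
apply: (uniformly_locally_constant r0) => {}x y xy.
have h1 : `|act B (c x) (F x) - act B (c y) (F y)| < e.
  by rewrite -!cP; apply: Fr; rewrite act_dist.
have h2 : `|act B (c x) (F y) - act B (c x) (F x)| < e.
  by rewrite act_dist distrC Fr.
apply: (@act_sep R _ B _ _ (F y)); apply: lt_le_trans epi.
rewrite -(subrKA (act B (c x) (F x))); apply: le_lt_trans (ler_normD _ _) _.
have e0 : 0 < e by apply: le_lt_trans h1.
by move: h1 h2; move: `|_| `|_| => p q; lra.
Qed.

(** The deck action is free, so [phi m] is determined by its effect at the single point [F 0], and
    multiplicativity is read off there. *)
Lemma deck_hom A B (f : real_bott R A -> real_bott R B)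
    (F : 'rV[R]_n -> 'rV[R]_n) (e r : R) : 0 < r -> 4 * e <= pi ->
  (forall x, proj B (F x) = f (proj A x)) ->
  (forall x y, `|x - y| < r -> `|F x - F y| < e) ->
  exists2 phi : 'rV[int]_n -> 'rV[int]_n,
    forall m x, F (act A m x) = act B (phi m) (F x) &
    forall a b, phi (bott_mul A a b) = bott_mul B (phi a) (phi b).
Proof.
move=> r0 epi FE Fr; have ex := deck_equivariant r0 epi FE Fr.
pose phi m := xget 0 [set a | forall x, F (act A m x) = act B a (F x)].
have phiP m x : F (act A m x) = act B (phi m) (F x).
  exact: (@xgetPex _ 0 [set a | forall x, F (act A m x) = act B a (F x)] (ex m)).
exists phi => // a b; apply: (@act_inj R _ B _ _ (F 0)).
by rewrite -phiP !act_mul -!phiP.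
Qed.

Lemma sq_invariants_diffeo A B : real_bott_diffeo R A B ->
  sq_fibers A = sq_fibers B /\ sq_additive A = sq_additive B.
Proof.
case=> f [sf [g [fK gK sg]]].
have pi4 : 0 < pi / 4 :> R by rewrite divr_gt0 ?pi_gt0.
have epi : 4 * (pi / 4) <= pi :> R by rewrite mulrC divfK.
have [r r0 [G [GE Gr]]] := lift_diffeo sg pi4 epi.
(* The bound [r] lets [G] be applied after [F] with its own closeness estimate; the bound [pi / 4]
   is what lifting [f] requires. *)
pose e := Num.min r (pi / 4).
have e0 : 0 < e by rewrite lt_min r0.
have epi' : 4 * e <= pi.
  by apply: le_trans epi; rewrite ler_pM2l // ge_min lexx orbT.
have [s s0 [F [FE Fs]]] := lift_diffeo sf e0 epi'.
have [phi phiP phiM] := deck_hom s0 epi' FE Fs.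
have [psi psiP psiM] := deck_hom r0 epi GE Gr.
have GFE x : proj A (G (F x)) = proj A x by rewrite GE FE fK.
have [tau tauP] : exists a, forall x, G (F x) = act A a x.
  have ex x : exists a, G (F x) = act A a x.
    by apply/real_bott_projP; rewrite GFE.
  pose c x := xget 0 [set a | G (F x) = act A a x].
  have cP x : G (F x) = act A (c x) x.
    exact: (@xgetPex _ 0 [set a | G (F x) = act A a x] (ex x)).
  exists (c 0) => x; rewrite cP; congr act.
  (* Below [s] the images under [G \o F] are within [pi / 4]; below [pi / 4] so are the points
     themselves. The two errors add up to less than [pi]. *)
  have t0 : 0 < Num.min s (pi / 4) by rewrite lt_min s0.
  apply: (uniformly_locally_constant t0) => {}x y; rewrite lt_min => /andP[xs xpi].
  have h1 : `|act A (c x) x - act A (c y) y| < pi / 4.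
    rewrite -!cP; apply: Gr; apply: lt_le_trans (Fs _ _ xs) _.
    by rewrite ge_min lexx.
  apply: (@act_sep R _ A _ _ y); apply: lt_le_trans epi.
  rewrite -(subrKA (act A (c x) x)); apply: le_lt_trans (ler_normD _ _) _.
  rewrite act_dist distrC; move: h1 xpi.
  by move: (pi / 4) pi4 `|_| `|_| => p p0 t u; lra.
(* Both sides describe the map [G \o F \o act A a], computed in two ways and compared at 0 by
   freeness. *)
have psiphi a : bott_mul A (psi (phi a)) tau = bott_mul A tau a.
  by apply: (@act_inj R _ A _ _ 0); rewrite !act_mul -!tauP -psiP -phiP.
by split; [apply: sq_fibers_iso psiphi | apply: sq_additive_iso psiphi].
Qed.

End DeckGroup.

(** * Affine diffeomorphisms *)

Section AffineDiffeo.
Local Open Scope classical_set_scope.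
Local Open Scope ring_scope.
Variables (R : realType) (n : nat).
Implicit Types (P Q : 'M[R]_n) (c x y : 'rV[R]_n) (A B : 'M[bool]_n).
Local Notation proj A := (@real_bott_proj R n A).

Definition affine P c x : 'rV[R]_n := x *m P + c.

Lemma affineK P Q c : P *m Q = 1%:M ->
  cancel (affine P c) (affine Q (- (c *m Q))).
Proof. by move=> PQ x; rewrite /affine mulmxDl -mulmxA PQ mulmx1 addrK. Qed.

Lemma affineVK P Q c : Q *m P = 1%:M ->
  cancel (affine Q (- (c *m Q))) (affine P c).
Proof.
by move=> QP x; rewrite /affine mulmxDl mulNmx -!mulmxA QP !mulmx1 subrK.
Qed.

Lemma mulmxr_continuous P : continuous (mulmxr P : 'rV[R]_n -> 'rV[R]_n).
Proof.
move=> x; apply: differentiable_continuous.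
rewrite (_ : (mulmxr P : _ -> _) =
    \sum_i (fun x : 'rV[R]_n => x 0 i *: row i P)); last first.
  by apply/funext => y; rewrite fct_sumE /= mulmx_sum_row.
apply: differentiable_sum => i; apply: differentiableZl.
exact: differentiable_coord.
Qed.

Lemma affine_differentiable P c x : differentiable (affine P c) x.
Proof.
apply: differentiableD; last exact: differentiable_cst.
by apply: (@linear_differentiable _ _ _ (mulmxr P)); exact: mulmxr_continuous.
Qed.

Lemma affine_continuous P c : continuous (affine P c).
Proof. by move=> x; exact/differentiable_continuous/affine_differentiable. Qed.

Lemma derive_affine P c v x : 'D_v (affine P c) x = v *m P.
Proof.
apply: cvg_lim => //; apply: cvg_near_cst.
near=> h; have h0 : h != 0 by near: h; exact: nbhs_dnbhs_neq.
rewrite /affine /= mulmxDl -scalemxAl -[_ + _ + c]addrA addrK scalerA.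
by rewrite mulVf // scale1r.
Unshelve. all: by end_near. Qed.

Lemma smooth_on_cst (U : set 'rV[R]_n) c : smooth_on U (fun _ => c).
Proof.
move=> k; elim: k c => [|k IH] c /=; first by move=> x _; exact: cst_continuous.
split=> [x _|v]; first exact: differentiable_cst.
have -> : (fun x : 'rV[R]_n => 'D_v (fun _ : 'rV[R]_n => c) x) = (fun _ => 0).
  by apply/funext => x; rewrite derive_cst.
exact: IH.
Qed.

Lemma smooth_on_affine (U : set 'rV[R]_n) P c : smooth_on U (affine P c).
Proof.
case=> [x _|k]; first exact: affine_continuous.
split=> [x _|v]; first exact: affine_differentiable.
have -> : (fun x => 'D_v (affine P c) x) = (fun _ => v *m P).
  by apply/funext => x; rewrite derive_affine.
exact: smooth_on_cst.
Qed.

(** Two points of such a ball are less than [pi] apart, too close to differ by a nontrivial deck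
    element. *)
Lemma proj_inj_ball A x : set_inj (ball x (pi / 2)) (proj A).
Proof.
move=> u v; rewrite !inE -ball_normE /= => xu xv /real_bott_projP[m vE].
have uv : `|u - v| < pi.
  rewrite (splitr pi) -(subrKA x) (le_lt_trans (ler_normD _ _)) //.
  by rewrite ltrD // distrC.
rewrite vE -(@act_sep _ _ A 0 m u) ?act0 //.
by rewrite -vE.
Qed.

(** The charts are the local inverses over a small ball [V] and over its affine image [W]. In them
    [f] is the affine map itself, and injectivity over [W] is transported from [V]. *)
Lemma smooth_map_affine A B P Q c (f : real_bott R A -> real_bott R B) :
    P *m Q = 1%:M -> Q *m P = 1%:M ->
    (forall x, f (proj A x) = proj B (affine P c x)) ->
    (forall x y, proj B (affine P c x) = proj B (affine P c y) ->
      proj A x = proj A y) ->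
  smooth_map (@real_bott_atlas R n A) (@real_bott_atlas R n B) f.
Proof.
move=> PQ QP fE finj z; have [x <-] := real_bott_proj_surj z.
pose V := ball x (pi / 2) : set 'rV[R]_n; pose W := affine P c @` V.
have injV := @proj_inj_ball A x.
have injW : set_inj W (proj B).
  move=> _ _ /set_mem[u Vu <-] /set_mem[v Vv <-] /finj uv.
  by rewrite (injV u v) ?inE.
have openW : open W.
  rewrite (_ : W = affine Q (- (c *m Q)) @^-1` V).
    by apply: open_comp; [move=> y _; exact: affine_continuous | exact: ball_open].
  rewrite predeqE => y; split=> [[v Vv <-]|Vy] /=.
    by rewrite (affineK _ PQ).
  by exists (affine Q (- (c *m Q)) y); rewrite ?(affineVK _ QP).
pose cV := Chart (proj A @` V) (fun m => xget 0 [set v | V v /\ proj A v = m]).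
pose cW := Chart (proj B @` W) (fun m => xget 0 [set w | W w /\ proj B w = m]).
have cVK v : V v -> cV (proj A v) = v.
  move=> Vv; have [] : V (cV (proj A v)) /\ proj A (cV (proj A v)) = proj A v.
    by apply: (@xgetPex _ 0 [set u | V u /\ proj A u = proj A v]); exists v.
  by move=> Vc; apply: injV; rewrite inE.
have cWK w : W w -> cW (proj B w) = w.
  move=> Ww; have [] : W (cW (proj B w)) /\ proj B (cW (proj B w)) = proj B w.
    by apply: (@xgetPex _ 0 [set u | W u /\ proj B u = proj B w]); exists w.
  by move=> Wc; apply: injW; rewrite inE.
exists cV, cW; split.
- exists V; split=> //; first exact: ball_open.
  by move=> v /set_mem; exact: cVK.
- by exists W; split=> // w /set_mem; exact: cWK.
- by exists x => //; apply: ballxx; rewrite divr_gt0 ?pi_gt0.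
- by move=> _ [_ [v Vv <-] <-]; exists (affine P c v); rewrite ?fE //; exists v.
exists (affine P c); first exact: smooth_on_affine.
move=> _ [v Vv <-]; rewrite cVK // fE cWK //; by exists v.
Qed.

(** The two directions of the equivalence say that the affine bijection descends to the quotients
    and that the induced map is injective. *)
Definition affine_equiv A B := exists P Q c, [/\ P *m Q = 1%:M, Q *m P = 1%:M &
  forall x y, proj A x = proj A y <->
    proj B (affine P c x) = proj B (affine P c y)].

Lemma affine_equiv_refl A : affine_equiv A A.
Proof.
by exists 1%:M, 1%:M, 0; split; rewrite ?mulmx1 // => x y;
  rewrite /affine !mulmx1 !addr0.
Qed.

Lemma affine_equiv_sym A B : affine_equiv A B -> affine_equiv B A.
Proof.
case=> P [Q [c [PQ QP E]]]; exists Q, P, (- (c *m Q)); split=> // x y.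
by rewrite E !(affineVK _ QP).
Qed.

Lemma affine_equiv_trans A B C :
  affine_equiv A B -> affine_equiv B C -> affine_equiv A C.
Proof.
case=> P [Q [c [PQ QP E]]] [P' [Q' [c' [PQ' QP' E']]]].
exists (P *m P'), (Q' *m Q), (c *m P' + c'); split.
- by rewrite mulmxA -(mulmxA P) PQ' mulmx1.
- by rewrite mulmxA -(mulmxA Q') QP mulmx1.
move=> x y; rewrite E E'.
have comp z : affine P' c' (affine P c z) = affine (P *m P') (c *m P' + c') z.
  by rewrite /affine mulmxDl mulmxA addrA.
by rewrite !comp.
Qed.

Lemma affine_equiv_diffeo A B : affine_equiv A B -> real_bott_diffeo R A B.
Proof.
case=> P [Q [c [PQ QP E]]].
pose sA (z : real_bott R A) := xget 0 [set x | proj A x = z].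
pose sB (z : real_bott R B) := xget 0 [set x | proj B x = z].
have sAK z : proj A (sA z) = z.
  exact: (@xgetPex _ 0 [set x | proj A x = z] (real_bott_proj_surj z)).
have sBK z : proj B (sB z) = z.
  exact: (@xgetPex _ 0 [set x | proj B x = z] (real_bott_proj_surj z)).
pose f z := proj B (affine P c (sA z)).
pose g z := proj A (affine Q (- (c *m Q)) (sB z)).
have fE x : f (proj A x) = proj B (affine P c x) by apply/E; rewrite sAK.
have gE y : g (proj B y) = proj A (affine Q (- (c *m Q)) y).
  by apply/E; rewrite !(affineVK _ QP) sBK.
exists f; split.
  by apply: (smooth_map_affine PQ QP fE) => x y /E.
exists g; split=> [z|z|].
- by have [x <-] := real_bott_proj_surj z; rewrite fE gE (affineK _ PQ).
- by have [x <-] := real_bott_proj_surj z; rewrite gE fE (affineVK _ QP).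
by apply: (smooth_map_affine QP PQ gE) => x y /E; rewrite !(affineVK _ QP).
Qed.

End AffineDiffeo.

(** * The three elementary moves on Bott matrices *)

Section Moves.
Local Open Scope ring_scope.
Variables (R : realType) (n : nat).
Implicit Types (P Q : 'M[R]_n) (c x y : 'rV[R]_n) (A B : 'M[bool]_n).
Implicit Types (i j k l : 'I_n).
Local Notation proj A := (@real_bott_proj R n A).

(* The [e_i] generate: split off the first nonzero coordinate of [m]. *)
Lemma act_gen_invariant (T : Type) A (h : 'rV[R]_n -> T) :
  (forall i x, h (act A (delta_mx 0 i) x) = h x) ->
  forall m x, h (act A m x) = h x.
Proof.
move=> hA.
have twz i (z : int) j : (j <= i)%N -> twist A (par (z *: delta_mx 0 i)) j = false.
  move=> ji; rewrite /twist big1 // => k /andP[kj _]; rewrite !mxE.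
  by rewrite (_ : k == i = false) ?mulr0 //; apply/negbTE; rewrite -val_eqE /=; lia.
have mulz i (z z' : int) :
    bott_mul A (z *: delta_mx 0 i) (z' *: delta_mx 0 i) = (z + z') *: delta_mx 0 i.
  apply/rowP => j; rewrite !mxE; case: (eqVneq j i) => [->|_] /=.
    by rewrite twz // !mulr1 mul1r.
  by rewrite !mulr0 addr0.
have hz i (z : int) x : h (act A (z *: delta_mx 0 i) x) = h x.
  have pos (N : nat) y : h (act A (N%:Z *: delta_mx 0 i) y) = h y.
    elim: N y => [|N IH] y; first by rewrite scale0r act0.
    by rewrite -[N.+1]addn1 PoszD -mulz act_mul IH scale1r hA.
  case: z => [N|N]; first exact: pos.
  by rewrite NegzE -(pos N.+1) -act_mul mulz addrN scale0r act0.
move=> m x.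
suff H (N : nat) (m' : 'rV[int]_n) : (N <= n)%N ->
    (forall j, (j < n - N)%N -> m' 0 j = 0) ->
    forall y, h (act A m' y) = h y.
  by apply: (H n) => // j; rewrite subnn.
elim: N m' => [|N IH] m' Nn m'0 y.
  suff -> : m' = 0 by rewrite act0.
  by apply/rowP => j; rewrite mxE m'0 // subn0.
have iP : (n - N.+1 < n)%N by lia.
pose i := Ordinal iP; pose z := m' 0 i.
pose m2 := bott_mul A (- z *: delta_mx 0 i) m'.
have -> : m' = bott_mul A (z *: delta_mx 0 i) m2.
  apply/rowP => j; rewrite !mxE scaleNr parN.
  case: (eqVneq j i) => [->|ji] /=.
    by rewrite twz // !mulr1 !mul1r addrA subrr add0r.
  by rewrite !mulr0 !add0r signrMK.
rewrite act_mul hz IH //; first by lia.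
move=> j jN; rewrite !mxE scaleNr parN; case: (eqVneq j i) => [->|ji] /=.
  by rewrite twz // mulr1 mul1r addNr.
have ltji : (j < i)%N by move/negbTE: ji; rewrite -val_eqE /=; lia.
by rewrite m'0 // !mulr0 addr0.
Qed.

Definition respects A B (F : 'rV[R]_n -> 'rV[R]_n) :=
  forall i, exists m, forall x, F (act A (delta_mx 0 i) x) = act B m (F x).

Lemma respects_proj A B F : respects A B F ->
  forall x y, proj A x = proj A y -> proj B (F x) = proj B (F y).
Proof.
move=> FAB x y /real_bott_projP[m ->]; apply/esym.
apply: (act_gen_invariant (h := fun x => proj B (F x))) => i {}x.
by have [m' ->] := FAB i; apply/esym/real_bott_projP; exists m'.
Qed.

Lemma affine_equiv_gen A B P Q c G :
  P *m Q = 1%:M -> Q *m P = 1%:M -> cancel (affine P c) G ->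
  respects A B (affine P c) -> respects B A G -> affine_equiv R A B.
Proof.
move=> PQ QP FK FAB GBA; exists P, Q, c; split=> // x y.
split=> [|/(respects_proj GBA)]; first exact: respects_proj.
by rewrite !FK.
Qed.

Lemma signr_half_turn (b : bool) : (-1) ^+ b * pi + - ((-1) ^+ b * (pi / 2)) =
  (-1) ^+ b * (pi / 2) :> R.
Proof. by rewrite {1}(splitr pi) mulrDr addrK. Qed.

(* Conjugating by a quarter translation of the [k]-th circle multiplies every
   generator that reflects that circle by the [k]-th one. *)
Lemma affine_equiv_translate A k :
  affine_equiv R A
    (\matrix_(i, j) (A i j (+) [&& (i < k)%N, (k < j)%N, A i k & A k j])).
Proof.
pose B A' : 'M[bool]_n := \matrix_(i, j)
  (A' i j (+) [&& (i < k)%N, (k < j)%N, A' i k & A' k j]).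
have BK : involutive B.
  move=> A'; apply/matrixP => i j; rewrite !mxE !ltnn /= !andbF !addbF.
  by rewrite -addbA addbb addbF.
(* The move is an involution on matrices, so one computation with a sign [b] treats both the
   translation and its inverse. *)
pose F (b : bool) x := affine 1%:M (((-1) ^+ b * (pi / 2)) *: delta_mx 0 k) x.
have FAB (b : bool) A' : respects A' (B A') (F b).
  move=> i; pose t := (i < k)%N && A' i k.
  (* Passing the quarter translation through a reflection of circle [k] costs a half turn of that
     circle, which is the translation part of the [k]-th generator. *)
  exists (delta_mx 0 i + (if t then (-1) ^+ b *: delta_mx 0 k else 0)) => x.
  have parE : par (delta_mx 0 i + (if t then (-1) ^+ b *: delta_mx 0 k else 0)) =
      par (delta_mx 0 i) + (if t then par (delta_mx 0 k) else 0).
    rewrite parD; congr (_ + _); case: ifP => _; last exact: par0.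
    by case: b; rewrite ?scaleN1r ?parN ?scale1r.
  apply/rowP => j; rewrite /F /affine !mulmx1 !mxE parE twistD.
  rewrite [twist _ (if _ then _ else _) _]
    (_ : _ = [&& t, (k < j)%N & B A' k j]); last first.
    by case: (t); rewrite ?twist_delta ?twist0.
  rewrite !twist_delta.
  rewrite [X in (-1) ^+ (nat_of_bool X) * (_ + _)]
     (_ : _ = ((i < j)%N && B A' i j) (+) [&& t, (k < j)%N & B A' k j]) //.
  rewrite !mxE; case: (eqVneq j k) => [->|jk] /=.
    rewrite !ltnn !andbF addbF /= !mulr1.
    rewrite -/t addbF; case: (boolP t) => [tT|tF].
      have ik : (k == i) = false.
        by apply/negbTE; case/andP: tT => ? _; rewrite -val_eqE /=; lia.
      rewrite !mxE ik /= -/t tT eqxx add0r mulr1 rmorph_sign mul0r addr0.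
      by rewrite expr1 !mulN1r opprD -addrA; congr (_ + _); rewrite addrC signr_half_turn.
    by rewrite mxE addr0 -/t (negbTE tF) expr0 !mul1r addrAC.
  have z : (if t then (-1) ^+ b *: delta_mx 0 k else 0 : 'rV[int]_n) 0 j = 0.
    by case: (t); rewrite !mxE ?(negbTE jk) ?andbF ?mulr0.
  rewrite z !mulr0 !addr0.
  rewrite !ltnn /= addbF; congr ((-1) ^+ _ * _ + _); congr nat_of_bool.
  rewrite /t; case: (ltnP i k) => ik /=; last by rewrite !addbF.
  case: (ltnP k j) => kj /=; last by rewrite andbF !addbF.
  by rewrite (ltn_trans ik kj) /= -addbA addbb addbF.
apply: (@affine_equiv_gen A (B A) 1%:M 1%:M _ (F true)).
- by rewrite mulmx1.
- by rewrite mulmx1.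
- move=> x; rewrite /F /affine !mulmx1 expr1 mulN1r scaleNr; exact: addrK.
- by have := FAB false A; rewrite /F expr0 mul1r.
by have := FAB true (B A); rewrite BK.
Qed.

Lemma mulmx_delta x k l (s : R) :
  x *m (1%:M + s *: delta_mx k l) = \row_j (x 0 j + (j == l)%:R * (s * x 0 k)).
Proof.
rewrite mulmxDr mulmx1 -scalemxAr; apply/rowP => j; rewrite !mxE; congr (_ + _).
rewrite (bigD1 k) //= big1 ?addr0 => [|i ik]; last by rewrite mxE (negbTE ik) mulr0.
by rewrite mxE eqxx /= mulrA mulrC.
Qed.

(* Two circles reflected by the same generators can be sheared along each
   other. *)
Lemma affine_equiv_slide A k l : (k < l)%N -> ~~ A k l ->
  (forall i, i != k -> i != l -> ((i < k)%N && A i k) = ((i < l)%N && A i l)) ->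
  affine_equiv R A
    (\matrix_(i, j) (A i j (+) [&& i == k, (l < j)%N & A l j])).
Proof.
move=> kl; have lk : (l == k) = false by apply/negbTE; rewrite -val_eqE /=; lia.
have kl' : (k == l) = false by rewrite eq_sym.
pose B A' : 'M[bool]_n :=
  \matrix_(i, j) (A' i j (+) [&& i == k, (l < j)%N & A' l j]).
have BK : involutive B.
  move=> A'; apply/matrixP => i j; rewrite !mxE lk /= addbF.
  by rewrite -addbA addbb addbF.
pose ok A' := ~~ A' k l /\ forall i, i != k -> i != l ->
  ((i < k)%N && A' i k) = ((i < l)%N && A' i l).
have okB A' : ok A' -> ok (B A').
  move=> [kl0 cols]; split; first by rewrite mxE ltnn andbF addbF.
  by move=> i ik il; rewrite !mxE (negbTE ik) /= !addbF cols.
pose F (b : bool) x := affine (1%:M + (-1) ^+ b *: delta_mx k l) 0 x.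
have FAB (b : bool) A' : ok A' -> respects A' (B A') (F b).
  move=> [kl0 cols] i.
  (* The [k]-th generator shifts [x_k] by [pi], so the sheared coordinate [x_l] shifts by [pi] up to
     sign and the [l]-th generator enters. The others change the signs of [x_k] and [x_l] together
     and commute with the shear. *)
  exists (delta_mx 0 i + (if i == k then (-1) ^+ b *: delta_mx 0 l else 0)) => x.
  have parE :
      par (delta_mx 0 i + (if i == k then (-1) ^+ b *: delta_mx 0 l else 0)) =
      par (delta_mx 0 i) + (if i == k then par (delta_mx 0 l) else 0).
    rewrite parD; congr (_ + _); case: ifP => _; last exact: par0.
    by case: b; rewrite ?scaleN1r ?parN ?scale1r.
  apply/rowP => j; rewrite /F /affine !addr0 !mulmx_delta.
  have tw : twist (B A') (par (delta_mx 0 i +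
      (if i == k then (-1) ^+ b *: delta_mx 0 l else 0))) j = (i < j)%N && A' i j.
    rewrite parE twistD twist_delta; case: (eqVneq i k) => [->|ik]; last first.
      by rewrite twist0 addr0 mxE (negbTE ik) addbF.
    rewrite twist_delta !mxE eqxx lk /= addbF.
    case: (ltnP l j) => lj; last by rewrite addbF addr0.
    by rewrite (ltn_trans kl lj) /= -[LHS]addbA addbb addbF.
  rewrite !mxE tw !twist_delta.
  case: (eqVneq j l) => [->|jl]; last first.
    rewrite !mul0r !addr0; congr (_ + _); congr (_%:~R * _).
    by case: ifP; rewrite !mxE ?(negbTE jl) ?andbF ?mulr0 addr0.
  rewrite !mul1r; case: (eqVneq i k) => [->|ik].
    rewrite !mxE !ltnn (negbTE kl0) andbF lk /= eqxx.
    by rewrite add0r mulr1 rmorph_sign mul0r addr0 !expr0 !mul1r mulrDr addrA.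
  rewrite [(0 : 'rV[int]_n) 0 l]mxE addr0 andbF /= mul0r addr0.
  case: (eqVneq i l) => [->|il] /=; last first.
    by rewrite cols // mul0r !addr0 mulrDr [in RHS]mulrCA.
  by rewrite ltnn ltnNge (ltnW kl) /= !expr0 !mul1r addrAC.
move=> kl0 cols; have okA : ok A by [].
apply: (@affine_equiv_gen A (B A) (1%:M + delta_mx k l) (1%:M - delta_mx k l) 0
  (F true)).
- rewrite mulmxBr mulmx1 mulmxDl mul1mx mul_delta_mx_0 ?lk //.
  by rewrite addr0 addrK.
- rewrite mulmxDr mulmx1 mulmxBl mul1mx mul_delta_mx_0 ?lk //.
  by rewrite subr0 subrK.
- move=> x; have := mulmx_delta x k l 1; rewrite scale1r /F /affine !addr0 => ->.
  rewrite mulmx_delta; apply/rowP => j; rewrite !mxE kl' mul0r addr0 !mul1r.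
  by rewrite expr1 mulN1r mulrN addrK.
- by have := FAB false A okA; rewrite /F expr0 scale1r.
by have := FAB true (B A) (okB _ okA); rewrite BK.
Qed.

(** The hypothesis says that [s] keeps the order of any two indices joined by an entry of [A]. As
    [twist] reads only entries with [i < j], the coordinate permutation then sends each generator to
    a generator. *)
Lemma affine_equiv_perm A (s : 'S_n) :
  (forall i j,
    ((i < j)%N && A (s i) (s j)) = ((s i < s j)%N && A (s i) (s j))) ->
  affine_equiv R A (\matrix_(i, j) A (s i) (s j)).
Proof.
move=> mono.
apply: (@affine_equiv_gen A _ (perm_mx s^-1%g) (perm_mx s) 0 (col_perm s^-1%g)).
- by rewrite -perm_mxM mulVg perm_mx1.
- by rewrite -perm_mxM mulgV perm_mx1.
- by move=> x; rewrite /affine addr0 -col_permE -col_permM mulVg col_perm1.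
- move=> i; exists (delta_mx 0 ((s^-1)%g i)) => x.
  rewrite /affine !addr0 -!col_permE; apply/rowP => j.
  rewrite !mxE !twist_delta mxE.
  by rewrite mono permKV (can2_eq (permK s) (permKV s)).
move=> i; exists (delta_mx 0 (s i)) => x; apply/rowP => j.
rewrite !mxE !twist_delta mxE.
have := mono i ((s^-1)%g j); rewrite permKV => ->.
by rewrite (can2_eq (permKV s) (permK s)).
Qed.

End Moves.

(** * Enumeration in dimension five *)

Section FiniteLists.

Lemma forall_ord_iota n (p : pred nat) :
  [forall i : 'I_n, p i] = all p (iota 0 n).
Proof.
rewrite -val_enum_ord all_map; apply/forallP/allP => [H i _|H i]; first exact: H.
by apply: H; rewrite mem_enum.
Qed.

Lemma card_ord_iota n (p : pred nat) :
  #|[set i : 'I_n | p i]%SET| = count p (iota 0 n).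
Proof.
by rewrite -val_enum_ord count_map cardsE cardE enumT /enum_mem size_filter.
Qed.

Fixpoint words (n : nat) : seq (seq bool) :=
  if n is n'.+1 then map (cons false) (words n') ++ map (cons true) (words n')
  else [:: [::]].

Lemma mem_words n w : (w \in words n) = (size w == n).
Proof.
elim: n w => [|n IH] [|b w] //=.
- rewrite mem_cat; apply/negbTE/norP; split; apply/mapP => -[]//.
- rewrite mem_cat eqSS -IH; apply/orP/idP => [[] /mapP[u uw [_ ->]] //|ww].
  by case: b; [right | left]; apply/mapP; exists w.
Qed.

Lemma uniq_words n : uniq (words n).
Proof.
elim: n => //= n IH; rewrite cat_uniq !map_inj_uniq ?IH //=; try by move=> u v [].
rewrite andbT; apply/hasPn => _ /mapP[u _ ->]; by apply/mapP => -[].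
Qed.

Definition row_of_word n (w : seq bool) : 'rV[bool]_n := \row_j nth false w j.

Lemma row_of_word_inj n :
  {in [pred w | size w == n] &, injective (@row_of_word n)}.
Proof.
move=> u v /eqP un /eqP vn /rowP E.
apply: (@eq_from_nth _ false); first by rewrite un vn.
by move=> i; rewrite un => iN; have := E (Ordinal iN); rewrite !mxE.
Qed.

Lemma sum_words n (F : 'rV[bool]_n -> nat) :
  \sum_v F v = sumn [seq F (row_of_word n w) | w <- words n].
Proof.
rewrite sumnE big_map -[RHS](big_map (@row_of_word n) xpredT).
apply: perm_big; apply: uniq_perm.
- exact: index_enum_uniq.
- rewrite map_inj_in_uniq ?uniq_words // => u v; rewrite !mem_words.
  exact: row_of_word_inj.
move=> v; rewrite mem_index_enum; apply/esym/mapP.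
exists [seq v ord0 i | i <- enum 'I_n].
  by rewrite mem_words size_map size_enum_ord.
by apply/rowP => j; rewrite mxE (nth_map j) ?size_enum_ord // nth_ord_enum.
Qed.

Lemma uniq_map_transfer (T I J : eqType) (f : T -> I) (g : T -> J) (s : seq T) :
  {in s &, forall x y, f x = f y -> g x = g y} ->
  uniq (map g s) -> uniq (map f s).
Proof.
elim: s => //= x s IH fg /andP[gx gs]; apply/andP; split.
  apply: contra gx => /mapP[y ys fxy]; apply/mapP; exists y => //.
  by apply: fg => //; rewrite !inE ?eqxx ?ys ?orbT.
by apply: IH => // y z ys zs; apply: fg; rewrite inE ?ys ?zs orbT.
Qed.

Lemma uniq_map_inj (T I : eqType) (f : T -> I) (s : seq T) :
  uniq (map f s) -> {in s &, injective f}.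
Proof.
elim: s => //= x s IH /andP[fx fs] y z; rewrite !inE.
have notin w : w \in s -> f x = f w -> false.
  by move=> ws fxw; rewrite fxw map_f in fx.
move=> /predU1P[->|ys] /predU1P[->|zs] // E; last exact: IH.
  by have := notin z zs E.
by have := notin y ys (esym E).
Qed.

(** On [D] the relation is equality of [inv], so the classes are its fibres, and [reps] meets each
    fibre exactly once. *)
Lemma card_equivalence_partition (T : finType) (I : eqType) (e : rel T)
    (D : {set T}) (inv : T -> I) (reps : seq T) :
    {in D &, forall x y, e x y = (inv x == inv y)} ->
    {subset reps <= D} ->
    {in D, forall x, exists2 r, r \in reps & inv x = inv r} ->
    uniq (map inv reps) ->
  #|equivalence_partition e D| = size reps.
Proof.
move=> eE rD cover inv_uniq.
pose cls x := [set y in D | e x y]%SET.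
have clsE x y : x \in D -> y \in D -> (cls x == cls y) = (inv x == inv y).
  move=> xD yD; apply/eqP/eqP => [/setP/(_ y)|ixy].
    by rewrite !inE yD !eE // eqxx => /eqP.
  apply/setP => z; rewrite !inE; case: (boolP (z \in D)) => //= zD.
  by rewrite !eE // ixy.
have us : uniq (map cls reps).
  apply: uniq_map_transfer inv_uniq => x y xr yr /eqP.
  by rewrite clsE ?rD // => /eqP.
rewrite -(size_map cls) -(card_uniqP us); apply: eq_card => X.
apply/imsetP/mapP => [[x xD ->]|[r rr ->]]; last by exists r; rewrite ?rD.
have [r rr ixr] := cover x xD; exists r => //.
by apply/eqP; rewrite (clsE _ _ xD (rD _ rr)) ixr.
Qed.

End FiniteLists.

(** * Computable codes of matrices and the search for orbits *)

Section Codes.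

Definition ent (s : seq (seq bool)) (i j : nat) := nth false (nth [::] s i) j.
Definition tab (f : nat -> nat -> bool) := mkseq (fun i => mkseq (f i) 5) 5.
Definition code_mx (s : seq (seq bool)) : 'M[bool]_5 := \matrix_(i, j) ent s i j.

Lemma ent_tab f (i j : 'I_5) : ent (tab f) i j = f i j.
Proof. by rewrite /ent !nth_mkseq. Qed.

Definition translate_code s k :=
  tab (fun i j => ent s i j (+) [&& i < k, k < j, ent s i k & ent s k j]).

Definition slide_ok s k l := [&& k < l, ~~ ent s k l &
  all (fun i => [|| i == k, i == l |
                    ((i < k) && ent s i k) == ((i < l) && ent s i l)])
    (iota 0 5)].
Definition slide_code s k l :=
  tab (fun i j => ent s i j (+) [&& i == k, l < j & ent s l j]).

Definition swap k l i : nat := if i == k then l else if i == l then k else i.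
Definition swap_ok s k l := all (fun i => all (fun j =>
  ((i < j) && ent s (swap k l i) (swap k l j)) ==
  ((swap k l i < swap k l j) && ent s (swap k l i) (swap k l j)))
  (iota 0 5)) (iota 0 5).
Definition swap_code s k l := tab (fun i j => ent s (swap k l i) (swap k l j)).

(** Slides and swaps are tried on adjacent indices only. That these moves still join all
    diffeomorphic matrices is confirmed afterwards by the distinct invariants of the orbits
    found. *)
Definition neighbours s :=
  [seq translate_code s k | k <- iota 0 5] ++
  flatten [seq
    (if slide_ok s k k.+1 then [:: slide_code s k k.+1] else [::]) ++
    (if swap_ok s k k.+1 then [:: swap_code s k k.+1] else [::]) | k <- iota 0 4].

Fixpoint explore N (seen frontier : seq (seq (seq bool))) :=
  if N is N'.+1 then
    let new :=
      undup [seq t <- flatten (map neighbours frontier) | t \notin seen] in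
    explore N' (new ++ seen) new
  else seen.

Section Equiv.
Variable R : realType.

Lemma translate_code_equiv s (k : 'I_5) :
  affine_equiv R (code_mx s) (code_mx (translate_code s k)).
Proof.
have := affine_equiv_translate R (code_mx s) k; congr affine_equiv.
by apply/matrixP => i j; rewrite !mxE ent_tab.
Qed.

Lemma slide_code_equiv s (k l : 'I_5) : slide_ok s k l ->
  affine_equiv R (code_mx s) (code_mx (slide_code s k l)).
Proof.
case/and3P=> kl skl /allP cols.
have := @affine_equiv_slide R _ (code_mx s) k l kl; rewrite mxE => /(_ skl) H.
have {}H := H _; rewrite (_ : code_mx (slide_code s k l) =
  (\matrix_(i, j) (code_mx s i j (+) [&& i == k, (l < j)%N & code_mx s l j]))%R).
  apply: H => i ik il; rewrite !mxE; have := cols i.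
  by rewrite mem_iota ltn_ord !val_eqE (negbTE ik) (negbTE il) => /(_ isT)/eqP.
by apply/matrixP => i j; rewrite !mxE ent_tab.
Qed.

Lemma swapE (k l i : 'I_5) : swap k l i = tperm k l i.
Proof.
by rewrite /swap !val_eqE; case: tpermP => [->|->|/eqP/negbTE-> /eqP/negbTE->];
  rewrite ?eqxx //; case: eqP => // ->.
Qed.

Lemma swap_code_equiv s (k l : 'I_5) : swap_ok s k l ->
  affine_equiv R (code_mx s) (code_mx (swap_code s k l)).
Proof.
move=> /allP ok; have H := @affine_equiv_perm R _ (code_mx s) (tperm k l).
rewrite (_ : code_mx (swap_code s k l) =
  (\matrix_(i, j) code_mx s (tperm k l i) (tperm k l j))%R).
  apply: H => i j; rewrite !mxE -!swapE.
  have iI (m : 'I_5) : (m : nat) \in iota 0 5 by rewrite mem_iota ltn_ord.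
  by have /allP/(_ j (iI j))/eqP := ok i (iI i).
by apply/matrixP => i j; rewrite !mxE ent_tab !swapE.
Qed.

Lemma neighbours_equiv s t : t \in neighbours s ->
  affine_equiv R (code_mx s) (code_mx t).
Proof.
have iP k : k < 5 -> exists i : 'I_5, k = i by move=> k5; exists (Ordinal k5).
rewrite mem_cat => /orP[/mapP[k]|/flatten_mapP[k]]; rewrite mem_iota /= => k5.
  by have [i ->] := iP _ k5 => ->; exact: translate_code_equiv.
have [[i iE] [j jE]] := (iP k (ltnW k5), iP k.+1 k5); rewrite jE {1 2 3 4}iE {k5}.
rewrite mem_cat => /orP[]; case: ifP => // ok; rewrite inE => /eqP ->.
  exact: slide_code_equiv.
exact: swap_code_equiv.
Qed.

Lemma explore_equiv N s seen frontier t :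
    {in seen, forall u, affine_equiv R (code_mx s) (code_mx u)} ->
    {in frontier, forall u, affine_equiv R (code_mx s) (code_mx u)} ->
  t \in explore N seen frontier -> affine_equiv R (code_mx s) (code_mx t).
Proof.
elim: N seen frontier => [|N IH] seen frontier sE fE /=; first exact: sE.
have nE u :
    u \in undup [seq t <- flatten (map neighbours frontier) | t \notin seen] ->
    affine_equiv R (code_mx s) (code_mx u).
  rewrite mem_undup mem_filter => /andP[_ /flatten_mapP[v vf uv]].
  exact: affine_equiv_trans (fE v vf) (neighbours_equiv uv).
by apply: IH => // u; rewrite mem_cat => /orP[/nE|/sE].
Qed.

End Equiv.

(* A word of length 10 lists the entries above the diagonal. *)
Definition upper_pairs := [seq (i, j) | i <- iota 0 5, j <- iota i.+1 (4 - i)].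
Definition code_of_word w :=
  tab (fun i j => (i == j) || ((i, j) \in upper_pairs) &&
                                nth false w (index (i, j) upper_pairs)).
Definition rank_one_code s :=
  count (fun j => all (fun i => ent s i j == (i == j)) (iota 0 5)) (iota 0 5) == 1.
Definition rank_one_codes :=
  [seq s <- map code_of_word (words 10) | rank_one_code s].

Lemma rank_code s :
  (maximal_torus_rank (code_mx s) == 1) = rank_one_code s.
Proof.
rewrite /rank_one_code -card_ord_iota; congr (_ == 1); apply: eq_card => j.
rewrite !inE -forall_ord_iota; apply: eq_forallb => i; by rewrite mxE val_eqE.
Qed.

Lemma mem_upper_pairs (i j : 'I_5) :
  ((i : nat, j : nat) \in upper_pairs) = (i < j).
Proof. by case: i => -[|[|[|[|[|]]]]] // ?; case: j => -[|[|[|[|[|]]]]]. Qed.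

Lemma bott_mx_code w : bott_mx (code_mx (code_of_word w)).
Proof.
apply/andP; split; apply/forallP => i; first by rewrite mxE ent_tab eqxx.
apply/forallP => j; apply/implyP => ji; rewrite mxE ent_tab mem_upper_pairs.
by rewrite (gtn_eqF ji) ltnNge (ltnW ji).
Qed.

Lemma bott_mx_of_rank_oneP (A : 'M[bool]_5) :
  reflect (exists2 s, s \in rank_one_codes & A = code_mx s)
          (A \in bott_mx_of_rank 5 1).
Proof.
rewrite inE; apply: (iffP andP) => [[Ab Ar]|[s + ->]]; last first.
  rewrite mem_filter -rank_code => /andP[? /mapP[w _ sE]].
  by rewrite sE bott_mx_code -sE.
pose w := [seq A (inord p.1) (inord p.2) | p <- upper_pairs].
have AE : A = code_mx (code_of_word w).
  apply/matrixP => i j; rewrite mxE ent_tab mem_upper_pairs.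
  have /andP[/forallP Ad /forallP Au] := Ab.
  have [ij|ji|/val_inj ->] := ltngtP i j; last by rewrite Ad.
    rewrite /w (nth_map (0, 0)) ?index_mem ?mem_upper_pairs //.
    by rewrite nth_index ?mem_upper_pairs //= !inord_val.
  by apply/negbTE; have /forallP/(_ j)/implyP := Au i; apply.
exists (code_of_word w); last exact: AE.
by rewrite mem_filter -rank_code -AE Ar; apply/map_f; rewrite mem_words size_map.
Qed.

(** The scalar product over F_2; against the [j]-th strict column it gives [twist] at [j]. *)
Definition dot c w := foldr addb false [seq p.1 && p.2 | p <- zip c w].
Definition strict_columns s :=
  [seq [seq (i < j) && ent s i j | i <- iota 0 5] | j <- iota 0 5].
Definition sq_word cs w := [seq p.2 && ~~ dot p.1 w | p <- zip cs w].
Definition add_words (u v : seq bool) := [seq p.1 (+) p.2 | p <- zip u v].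

Lemma sqmap_code s w : size w = 5 ->
  sqmap (code_mx s) (row_of_word 5 w) =
  row_of_word 5 (sq_word (strict_columns s) w).
Proof.
move=> w5; apply/rowP => j; rewrite !mxE (nth_map ([::], false)) ?size_zip ?w5 //.
rewrite nth_zip ?w5 //=; congr (_ && ~~ _).
rewrite -[nth [::] _ _]/(nth [::] (strict_columns s) j) (nth_map 0) ?size_iota //.
rewrite nth_iota // add0n /dot foldrE big_map.
rewrite (big_nth (false, false)) size_zip size_map size_iota w5 big_mkord.
rewrite /twist big_mkcond; apply: eq_bigr => i _.
rewrite nth_zip ?size_map ?size_iota ?w5 // (nth_map 0) ?size_iota //.
rewrite nth_iota // add0n !mxE /=.
by case: (i < j)%N => //=; case: ent.
Qed.

Lemma size_sq_word cs w : size cs = 5 -> size w = 5 -> size (sq_word cs w) = 5.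
Proof. by move=> c5 w5; rewrite size_map size_zip c5 w5. Qed.

Lemma size_add_words u v : size u = 5 -> size v = 5 -> size (add_words u v) = 5.
Proof. by move=> u5 v5; rewrite size_map size_zip u5 v5. Qed.

Lemma row_of_add_words u v : size u = 5 -> size v = 5 ->
  row_of_word 5 (add_words u v) = (row_of_word 5 u + row_of_word 5 v)%R.
Proof.
move=> u5 v5; apply/rowP => j.
by rewrite !mxE (nth_map (false, false)) ?size_zip ?u5 ?v5 // nth_zip ?u5 ?v5.
Qed.

Definition sq_invariants_code s :=
  let cs := strict_columns s in
  let wqs := [seq (w, sq_word cs w) | w <- words 5] in
  (sumn [seq (sumn [seq (p.2 == q.2 : nat) | p <- wqs]) ^ 2 | q <- wqs],
   sumn [seq sumn [seq (add_words p.2 q.2 == sq_word cs (add_words p.1 q.1) : nat)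
                  | q <- wqs] | p <- wqs]).

Definition sq_invariants n (A : 'M[bool]_n) := (sq_fibers A, sq_additive A).

Lemma sq_invariants_codeE s : sq_invariants (code_mx s) = sq_invariants_code s.
Proof.
have eqE u v : size u = 5 -> size v = 5 ->
    (row_of_word 5 u == row_of_word 5 v) = (u == v).
  move=> u5 v5; apply/eqP/eqP => [|-> //].
  by apply: row_of_word_inj; rewrite inE ?u5 ?v5.
have cs5 : size (strict_columns s) = 5 by [].
rewrite /sq_invariants_code; move: (mem_words 5) (@sum_words 5).
move: (words 5) (strict_columns s) (@sqmap_code s) cs5 => ws cs sqE cs5 memw sumE.
rewrite -!map_comp; congr pair; rewrite ?/sq_fibers ?/sq_additive sumE; congr sumn;
  apply/eq_in_map => v; rewrite memw => /eqP v5 /=; rewrite sumE -map_comp.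
  congr (_ ^ 2); congr sumn; apply/eq_in_map => u; rewrite memw => /eqP u5 /=.
  by rewrite !sqE // eqE ?size_sq_word.
congr sumn; apply/eq_in_map => u; rewrite memw => /eqP u5 /=.
rewrite -row_of_add_words // !sqE ?size_add_words //.
by rewrite -row_of_add_words ?eqE ?size_add_words ?size_sq_word ?size_add_words.
Qed.

(* Eight rounds exhaust the largest orbit; a smaller bound would only split
   orbits, never merge them. *)
Definition rank_one_orbits := foldr (fun s acc =>
  if s \in flatten (map snd acc) then acc else (s, explore 8 [:: s] [:: s]) :: acc)
  [::] rank_one_codes.

(** Covering all codes by 29 orbits bounds the number of classes from above. Distinct invariants of
    the representatives, themselves of rank one, bound it from below. *)
Lemma rank_one_orbits_check :
  [&& (let ss := flatten (map snd rank_one_orbits) in all [in ss] rank_one_codes),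
      all (fun p => p.1 \in rank_one_codes) rank_one_orbits,
      uniq [seq sq_invariants_code p.1 | p <- rank_one_orbits] &
      size rank_one_orbits == 29].
Proof. by vm_compute. Qed.

Lemma rank_one_orbits_equiv (R : realType) p s :
  p \in rank_one_orbits -> s \in p.2 -> affine_equiv R (code_mx p.1) (code_mx s).
Proof.
rewrite /rank_one_orbits; move: rank_one_codes 8 => cs N.
elim: cs p s => //= r rs IH p s.
case: ifP => _; first exact: IH.
rewrite inE => /orP[/eqP ->|]; last exact: IH.
by apply: explore_equiv => u; rewrite inE => /eqP ->; exact: affine_equiv_refl.
Qed.

End Codes.

Theorem proposition3p5 (R : realType) :
  #|equivalence_partition
      (fun A B : 'M[bool]_5 => `[< real_bott_diffeo R A B >])
      (bott_mx_of_rank 5 1)| = 29.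
Proof.
move: rank_one_orbits_check (@rank_one_orbits_equiv R) bott_mx_of_rank_oneP.
move: rank_one_orbits rank_one_codes => os cs.
move=> /and4P[/allP cover /allP codes uniq_inv /eqP <-] os_equiv csP.
rewrite -(size_map (fun p => code_mx p.1)).
have rep (A : 'M[bool]_5) : A \in bott_mx_of_rank 5 1 ->
    exists2 p, p \in os & affine_equiv R (code_mx p.1) A.
  move=> /csP[s sc ->].
  have /flatten_mapP[p po sp] := cover s sc.
  by exists p => //; exact: os_equiv sp.
have inv_diffeo (A B : 'M[bool]_5) :
    real_bott_diffeo R A B -> sq_invariants A = sq_invariants B.
  by move=> /sq_invariants_diffeo[f a]; congr pair.
have inv_inj : {in os &, forall p q,
    sq_invariants (code_mx p.1) = sq_invariants (code_mx q.1) -> p = q}.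
  move=> p q pr qr; rewrite !sq_invariants_codeE; exact: (uniq_map_inj uniq_inv).
apply: (@card_equivalence_partition _ _ _ _ (@sq_invariants 5)).
- move=> A B /rep[p po pA] /rep[q qo qB].
  apply/asboolP/eqP; first exact: inv_diffeo.
  have invA := inv_diffeo _ _ (affine_equiv_diffeo pA).
  have invB := inv_diffeo _ _ (affine_equiv_diffeo qB).
  (* Equal invariants force one common representative, through which [A] and [B] are affinely
     equivalent. *)
  rewrite -invA -invB => /(inv_inj _ _ po qo) pq; rewrite -pq in qB.
  apply: affine_equiv_diffeo; apply: affine_equiv_trans qB.
  exact: affine_equiv_sym.
- move=> _ /mapP[p po ->]; apply/csP; exists p.1 => //.
  exact: codes.
- move=> A /rep[p po pA]; exists (code_mx p.1); first by apply/mapP; exists p.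
  by rewrite (inv_diffeo _ _ (affine_equiv_diffeo pA)).
by rewrite -map_comp; under eq_map do rewrite /= sq_invariants_codeE.
Qed.
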